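(* Let $V$ be a vertex operator algebra, and suppose that Zhu's algebra $A(V)$ is semisimple. Then any admissible $V$-module $M$ is decomposed into a direct sum of generalized eigenspaces for $L(0)$, i.e., $M=\bigoplus_{\lambda\in\mathbb{C}}M^{(\lambda)}$.
   Context: $\mathbb{N}$ is the set of nonnegative integers. Let $V=(V,Y,\mathbf 1,\omega)$ be a vertex operator algebra over $\mathbb{C}$, $Y(a,z)=\sum_{n\in\mathbb{Z}}a(n)z^{-n-1}$, graded by eigenvalues of $L(0)=\omega(1)$; $\mathrm{wt}(a)$ denotes the $L(0)$-eigenvalue of a homogeneous $a$. A weak $V$-module is a vector space $M$ with a linear map $Y_M:V\to(\mathrm{End}\,M)[[z,z^{-1}]]$, $Y_M(a,z)=\sum_{n\in\mathbb{Z}}a(n)z^{-n-1}$, such that $Y_M(a,z)u\in M((z))$ for $a\in V$, $u\in M$, $Y_M(\mathbf 1,z)=\mathrm{id}_M$, and the Jacobi identity $z_0^{-1}\delta(\frac{z_1-z_2}{z_0})Y_M(a,z_1)Y_M(b,z_2)-z_0^{-1}\delta(\frac{z_2-z_1}{-z_0})Y_M(b,z_2)Y_M(a,z_1)=z_2^{-1}\delta(\frac{z_1-z_0}{z_2})Y_M(Y(a,z_0)b,z_2)$ holds. Write $Y_M(\omega,z)=\sum_nL(n)z^{-n-2}$. An admissible $V$-module is a weak $V$-module with an $\mathbb{N}$-grading $M=\bigoplus_{n=0}^\infty M_n$ such that $a(n)M_m\subset M_{\mathrm{wt}(a)+m-n-1}$ for homogeneous $a$ ($M_m=0$ for $m<0$).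 Zhu's algebra: for homogeneous $a\in V$ and $b\in V$ put $a\circ b=\mathrm{Res}_z\frac{(1+z)^{\mathrm{wt}(a)}}{z^2}Y(a,z)b$ and $a*b=\mathrm{Res}_z\frac{(1+z)^{\mathrm{wt}(a)}}{z}Y(a,z)b$ (extended linearly in $a$); $O(V)$ is the span of all $a\circ b$ and $A(V)=V/O(V)$, an associative algebra under $*$. For a weak $V$-module $M$ and $\lambda\in\mathbb{C}$, $M^{(\lambda)}=\{u\in M\mid (L(0)-\lambda)^ku=0\text{ for some }k\in\mathbb{N}\}$. *)

(* Defs.v *)
From HB Require Import structures.
From mathcomp Require Import all_boot all_order all_algebra.
From mathcomp Require Import generic_quotient ring_quotient.
From mathcomp Require Import mathcomp_extra boolp classical_sets functions.
From mathcomp Require Import cardinality fsbigop reals.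

Set Implicit Arguments.
Unset Strict Implicit.
Unset Printing Implicit Defensive.

Import Order.TTheory GRing.Theory Num.Theory.

Local Open Scope classical_set_scope.
Local Open Scope quotient_scope.
Local Open Scope ring_scope.

Section LinearAlgebra.
Context {K : fieldType}.

Definition subspace (M : lmodType K) (S : set M) : Prop :=
  submod_closed [in S].

Definition lin_span (M : lmodType K) (S : set M) : set M :=
  [set x | exists (n : nat) (c : 'I_n -> K) (v : 'I_n -> M),
     (forall i, S (v i)) /\ x = \sum_(i < n) c i *: v i].

Definition finite_dim (M : lmodType K) (S : set M) : Prop :=
  exists s : seq M, S `<=` lin_span [set` s].

(* [M] is the internal direct sum of the subspaces [E i]. *)
Definition direct_sum (I : choiceType) (M : lmodType K) (E : I -> set M) :
    Prop :=
  forall m : M, exists! f : I -> M,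
    [/\ forall i, E i (f i),
        finite_set [set i | f i != 0] &
        m = \sum_(i \in [set: I]) f i].

Definition component (I : choiceType) (M : lmodType K) (E : I -> set M)
    (hE : direct_sum E) (m : M) : I -> M :=
  sval (cid (hE m)).

(* 'C(n, i) for n in Z: the coefficient of z^i in (1 + z)^n. *)
Definition binz (n : int) (i : nat) : K :=
  (\prod_(j < i) (n%:~R - j%:R)) / i`!%:R.

End LinearAlgebra.

Section Semisimple.
Context {K : fieldType} {A : lmodType K} (mul : A -> A -> A).

Definition left_ideal (J : set A) : Prop :=
  subspace J /\ forall a x, J x -> J (mul a x).

Definition simple_left_ideal (J : set A) : Prop :=
  [/\ left_ideal J, J <> [set 0] &
      forall J', left_ideal J' -> J' `<=` J -> J' = [set 0] \/ J' = J].

(* The left regular module is a direct sum of simple modules. *)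
Definition semisimple_algebra : Prop :=
  exists (I : choiceType) (J : I -> set A),
    (forall i, simple_left_ideal (J i)) /\ direct_sum J.

End Semisimple.

(* A vertex operator is encoded by its modes: [Y a n] is a(n), the coefficient
   of z^(-n-1) in Y(a,z). *)
Section VertexOperators.
Context {K : numFieldType} {V M : lmodType K}.
Implicit Types (YV : V -> int -> {linear V -> V}).
Implicit Types (YM : V -> int -> {linear M -> M}).

(* Y_M(a,z)u belongs to M((z)). *)
Definition truncation YM : Prop :=
  forall a u, exists N : int, forall n, N <= n -> YM a n u = 0.

(* The coefficient of z0^(-l-1) z1^(-m-1) z2^(-n-1) in the Jacobi identity,
   applied to u. Binomials are expanded in nonnegative powers of their second
   variable; on the right, the coefficient (-1)^i 'C(i-m-1, i) coming from
   (z1 - z0)^(i-m-1) is rewritten as 'C(m, i). All sums have finite support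
   in the presence of [truncation]. *)
Definition jacobi YV YM : Prop :=
  forall (a b : V) (u : M) (l m n : int),
    \sum_(i \in [set: nat]) ((-1) ^+ i * binz l i) *:
       YM a (l + m - i%:Z) (YM b (n + i%:Z) u)
    - \sum_(i \in [set: nat]) ((-1) ^ l * (-1) ^+ i * binz l i) *:
       YM b (l + n - i%:Z) (YM a (m + i%:Z) u)
    = \sum_(i \in [set: nat]) (binz m i : K) *:
       YM (YV a (l + i%:Z) b) (m + n - i%:Z) u.

End VertexOperators.

Record voa (K : numFieldType) := VOA {
  voa_sort :> lmodType K;
  voa_Y : voa_sort -> int -> {linear voa_sort -> voa_sort};
  voa_one : voa_sort;
  voa_omega : voa_sort;
  voa_charge : K;
  voa_L := fun n : int => voa_Y voa_omega (n + 1);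
  voa_wt := fun n : int => [set v : voa_sort | voa_L 0 v = n%:~R *: v];
  voa_linear : forall n u, linear (fun a => voa_Y a n u);
  voa_truncation : truncation voa_Y;
  voa_vacuum : forall n u, voa_Y voa_one n u = if n == -1 then u else 0;
  voa_creation : forall a (n : int),
    -1 <= n -> voa_Y a n voa_one = if n == -1 then a else 0;
  voa_jacobi : jacobi voa_Y voa_Y;
  voa_virasoro : forall (m n : int) v,
    voa_L m (voa_L n v) - voa_L n (voa_L m v) =
      (m - n)%:~R *: voa_L (m + n) v
      + (if m + n == 0 then (m ^+ 3 - m)%:~R / 12%:R * voa_charge else 0) *: v;
  voa_derivative : forall a (n : int) v,
    voa_Y (voa_L (-1) a) n v = - n%:~R *: voa_Y a (n - 1) v;
  voa_grading : direct_sum voa_wt;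
  voa_wt_fin : forall n, finite_dim (voa_wt n);
  voa_wt_bounded : exists N : int, forall n, n < N -> voa_wt n = [set 0];
  voa_wt_one : voa_wt 0 voa_one;
  voa_wt_omega : voa_wt 2 voa_omega
}.

Arguments voa_Y {K} V a n : rename.
Arguments voa_one {K} V : rename.
Arguments voa_omega {K} V : rename.
Arguments voa_L {K} V n : rename.
Arguments voa_wt {K} V n _ : rename.
Arguments voa_grading {K} V : rename.

Record weak_module (K : numFieldType) (V : voa K) := WeakModule {
  wm_sort :> lmodType K;
  wm_Y : V -> int -> {linear wm_sort -> wm_sort};
  wm_linear : forall n u, linear (fun a => wm_Y a n u);
  wm_truncation : truncation wm_Y;
  wm_vacuum : forall n u, wm_Y (voa_one V) n u = if n == -1 then u else 0;
  wm_jacobi : jacobi (voa_Y V) wm_Y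
}.

Arguments wm_Y {K V} M a n : rename.

Section WeakModuleTheory.
Context {K : numFieldType} {V : voa K} (M : weak_module V).

Definition wm_L (n : int) : {linear M -> M} := wm_Y M (voa_omega V) (n + 1).

Definition gen_eigenspace (lambda : K) : set M :=
  [set u | exists k : nat, iter k (fun x => wm_L 0 x - lambda *: x) u = 0].

End WeakModuleTheory.

Arguments wm_L {K V} M n.
Arguments gen_eigenspace {K V} M lambda _.

Definition int_grading (T : nmodType) (G : nat -> set T) (n : int) : set T :=
  if n is Posz k then G k else [set 0].

Record admissible_module (K : numFieldType) (V : voa K) := AdmissibleModule {
  am_weak :> weak_module V;
  am_gr : nat -> set am_weak;
  am_subspace : forall n, subspace (am_gr n);
  am_grading : direct_sum am_gr;
  am_mode : forall (k n : int) (m : nat) a u,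
    voa_wt V k a -> am_gr m u ->
    int_grading am_gr (k + m%:Z - n - 1) (wm_Y am_weak a n u)
}.

Section ZhuAlgebra.
Context {K : numFieldType} (V : voa K).

(* Res_z (1 + z)^n z^(-k) Y(a,z) b *)
Definition zhu_res (n : int) (k : nat) (a b : V) : V :=
  \sum_(i \in [set: nat]) binz n i *: voa_Y V a (i%:Z - k%:Z) b.

Definition zhu_O : set V :=
  lin_span [set x | exists (n : int) (a b : V),
          voa_wt V n a /\ x = zhu_res n 2 a b].

Definition zhu_star (a b : V) : V :=
  \sum_(n \in [set: int]) zhu_res n 1 (component (voa_grading V) a n) b.

Definition zhu_O_pred : {pred V} := [in zhu_O].

Fact zhu_O_submod_closed : submod_closed zhu_O_pred.
Proof.
split=> [|k x y /set_mem [m [c [v [Sv ->]]]] /set_mem [n [d [w [Sw ->]]]]].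
  apply/mem_set; exists 0%N, (fun=> 0), (fun=> 0).
  by rewrite big_ord0; split => // -[].
apply/mem_set; exists (m + n)%N.
exists (fun i => match fintype.split i with inl j => k * c j | inr j => d j end).
exists (fun i => match fintype.split i with inl j => v j | inr j => w j end).
split=> [i|]; first by case: (fintype.split i).
rewrite big_split_ord /= scaler_sumr; congr (_ + _); apply: eq_bigr => i _.
  by rewrite (unsplitK (inl i)) scalerA.
by rewrite (unsplitK (inr i)).
Qed.

HB.instance Definition _ := GRing.isSubmodClosed.Build K V zhu_O_pred
  (GRing.submod_closed_semi zhu_O_submod_closed).

(* [ring_quotient] provides V / O(V) as an additive group only. *)
Definition zhu_quot : Type := {ideal_quot zhu_O_pred}.

HB.instance Definition _ := GRing.Zmodule.on zhu_quot.
HB.instance Definition _ := EqQuotient.on zhu_quot.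

Definition zhu_scale (k : K) : zhu_quot -> zhu_quot :=
  lift_op1 zhu_quot ( *:%R k).

Lemma pi_zhu_scale (k : K) : {morph \pi_zhu_quot : x / k *: x >-> zhu_scale k x}.
Proof.
move=> x; rewrite /zhu_scale; unlock; apply/eqP.
rewrite [_ == _]piE Quotient.equivE -scalerBr rpredZ //.
by rewrite Quotient.idealrBE reprK.
Qed.

Lemma pi_zhuD : {morph \pi_zhu_quot : x y / x + y}.
Proof. exact: (@Quotient.pi_add _ zhu_O_pred). Qed.

Fact zhu_scaleA (a b : K) (x : zhu_quot) :
  zhu_scale a (zhu_scale b x) = zhu_scale (a * b) x.
Proof. by elim/quotW: x => x; rewrite -!pi_zhu_scale scalerA. Qed.

Fact zhu_scale1 : left_id 1 zhu_scale.
Proof. by move=> x; elim/quotW: x => x; rewrite -pi_zhu_scale scale1r. Qed.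

Fact zhu_scaleDr : right_distributive zhu_scale +%R.
Proof.
move=> a x y; elim/quotW: x => x; elim/quotW: y => y.
by rewrite -!pi_zhu_scale -!pi_zhuD -pi_zhu_scale scalerDr.
Qed.

Fact zhu_scaleDl (x : zhu_quot) : {morph zhu_scale^~ x : a b / a + b}.
Proof.
move=> a b; elim/quotW: x => x.
by rewrite -!pi_zhu_scale scalerDl pi_zhuD.
Qed.

HB.instance Definition _ := GRing.Zmodule_isLmodule.Build K zhu_quot
  zhu_scaleA zhu_scale1 zhu_scaleDr zhu_scaleDl.

(* The product induced by * on V / O(V). It is computed on representatives,
   on which it does not depend by Zhu's theorem that O(V) is a two-sided ideal
   for *. *)
Definition zhu_mul : zhu_quot -> zhu_quot -> zhu_quot :=
  lift_op2 zhu_quot zhu_star.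

End ZhuAlgebra.

Arguments zhu_quot {K} V.
Arguments zhu_mul {K} V _ _.

(* Main.v *)
From HB Require Import structures.
From mathcomp Require Import all_boot all_order all_algebra.
From mathcomp Require Import generic_quotient ring_quotient.
From mathcomp Require Import finmap boolp classical_sets functions.
From mathcomp Require Import cardinality fsbigop reals complex.
From mathcomp Require Import ereal lebesgue_measure.
From mathcomp Require Import zify ring.
Require Import Defs.

Set Implicit Arguments.
Unset Strict Implicit.
Unset Printing Implicit Defensive.
Import Order.TTheory GRing.Theory Num.Theory.
Local Open Scope classical_set_scope.
Local Open Scope quotient_scope.
Local Open Scope ring_scope.
Local Open Scope complex_scope.

(** Call a vector of [M] locally finite when a nonzero polynomial in [L(0)]
    kills it. If all vectors are locally finite, Bezout's identity and the
    factorization of polynomials over [R[i]] split [M] into generalized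
    eigenspaces ([direct_sum_primary]). Since [[L(0), a(n)]] is a multiple of
    [a(n)] for homogeneous [a], the locally finite vectors form a submodule
    ([locally_finite_mode]).

    Local finiteness of [M_m] is proved by strong induction on the degree [m].
    Modulo the locally finite vectors, [u] in [M_m] is killed by every mode that
    lowers the degree, as if it were a lowest weight vector. For such vectors
    the Jacobi identity says that [a |-> o(a) u], where [o(a)] is the mode of
    [a] that preserves the degree, vanishes on [O(V)] ([zero_mode_O]) and turns
    multiplication by the conformal vector in Zhu's algebra into [L(0)]
    ([zero_mode_star]). A polynomial relation satisfied by the class of omega
    in [A(V)] therefore puts [p(L(0)) u] among the locally finite vectors, and
    [u] is locally finite too ([locally_finite_step]).

    Such a relation exists because left multiplication [T] by omega commutes
    with all left multiplications ([zhu_star_omega_comm]). On a simple left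
    ideal [J], Schur's argument shows that [T - l] is zero or onto for each
    scalar [l]. In the latter case for all [l], the vectors [(T - l)^-1 x]
    form an uncountable family in [A(V)], which has countable dimension because
    [V] has finite-dimensional weight spaces; a linear dependence between
    them is a polynomial relation for [T] at [x], and simplicity spreads it to
    all of [J] ([algebraic_simple_ideal]). Semisimplicity then makes [T]
    algebraic at every vector, in particular at the unit.

    For [A(V)] to make sense, [O(V)] must be a two-sided ideal. Zhu's proof
    computes with the residues [Res (1 + z)^p z^k Y(a,z)b], for which one
    identity suffices: the Jacobi identity with both vertex operators weighted
    by powers of [1 + z] ([smeared_jacobi]). It follows from the unweighted one
    by Pascal's rule. *)

(** * Sums with finite support, and binomial sums *)

Section Subspaces.
Context {K : fieldType} {M : lmodType K} (S : set M).
Hypothesis S_sub : subspace S.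

Lemma subspace0 : S 0.
Proof. by case: S_sub => /set_mem. Qed.

Lemma subspaceD x y : S x -> S y -> S (x + y).
Proof.
move=> Sx Sy; case: S_sub => _ /(_ 1 x y).
by rewrite scale1r => h; apply/set_mem/h; exact/mem_set.
Qed.

Lemma subspaceZ c x : S x -> S (c *: x).
Proof.
move=> Sx; case: S_sub => S0 /(_ c x 0).
by rewrite addr0 => h; apply/set_mem/h => //; exact/mem_set.
Qed.

Lemma subspaceB x y : S x -> S y -> S (x - y).
Proof.
by move=> Sx Sy; rewrite -scaleN1r; apply: subspaceD => //; apply: subspaceZ.
Qed.

Lemma subspace_sum (I : Type) (r : seq I) (F : I -> M) :
  (forall i, S (F i)) -> S (\sum_(i <- r) F i).
Proof.
by move=> SF; apply: big_ind => //; [exact: subspace0 | exact: subspaceD].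
Qed.

Lemma subspace_fsum (I : choiceType) (A : set I) (F : I -> M) :
  (forall i, S (F i)) -> S (\sum_(i \in A) F i).
Proof. by move=> SF; apply: subspace_sum. Qed.

End Subspaces.

Lemma subspaceP (K : fieldType) (M : lmodType K) (S : set M) :
  S 0 -> (forall c x y, S x -> S y -> S (c *: x + y)) -> subspace S.
Proof.
move=> S0 SD; split; first exact/mem_set.
by move=> c x y /set_mem Sx /set_mem Sy; apply/mem_set/SD.
Qed.

Section NatSums.
Context {K : numFieldType}.
Implicit Types M : lmodType K.

Definition eventually0 M (F : nat -> M) : Prop :=
  exists N, forall i, (N <= i)%N -> F i = 0.

Lemma nsumE M N (F : nat -> M) : (forall i, (N <= i)%N -> F i = 0) ->
  \sum_(i \in [set: nat]) F i = \sum_(i < N) F i.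
Proof.
move=> F0; rewrite (fsbigE (iota 0 N)) ?iota_uniq //; last first.
  by move=> i _; rewrite mem_iota add0n -leqNgt; apply: F0.
rewrite (eq_bigl xpredT) => [|i]; last by rewrite in_setT.
by rewrite -(big_mkord xpredT) /index_iota subn0.
Qed.

Lemma eventually0D M (F G : nat -> M) : eventually0 F -> eventually0 G ->
  exists N, forall i, (N <= i)%N -> F i = 0 /\ G i = 0.
Proof.
move=> [m F0] [n G0]; exists (maxn m n) => i; rewrite geq_max => /andP[mi ni].
by rewrite F0 ?G0.
Qed.

Lemma nsumD M (F G : nat -> M) : eventually0 F -> eventually0 G ->
  \sum_(i \in [set: nat]) (F i + G i) =
  \sum_(i \in [set: nat]) F i + \sum_(i \in [set: nat]) G i.
Proof.
move=> hF hG; have [N FG0] := eventually0D hF hG.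
rewrite !(@nsumE _ N) ?big_split // => i /FG0[] // -> ->.
by rewrite addr0.
Qed.

Lemma nsum_linear M M' (f : {linear M -> M'}) (F : nat -> M) : eventually0 F ->
  f (\sum_(i \in [set: nat]) F i) = \sum_(i \in [set: nat]) f (F i).
Proof.
move=> [N F0]; rewrite !(@nsumE _ N) ?linear_sum // => i /F0 ->.
by rewrite linear0.
Qed.

Lemma nsumZ M c (F : nat -> M) : eventually0 F ->
  c *: (\sum_(i \in [set: nat]) F i) = \sum_(i \in [set: nat]) c *: F i.
Proof.
move=> [N F0]; rewrite !(@nsumE _ N) ?scaler_sumr // => i /F0 ->.
by rewrite scaler0.
Qed.

Lemma nsumS M (F : nat -> M) : eventually0 F ->
  \sum_(i \in [set: nat]) F i = F 0%N + \sum_(i \in [set: nat]) F i.+1.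
Proof.
move=> [N F0]; rewrite (@nsumE _ N.+1) => [|i iN]; last by rewrite F0 // ltnW.
by rewrite (@nsumE _ N) ?big_ord_recl // => i iN; rewrite F0 // leqW.
Qed.

Lemma nsum_head M (F : nat -> M) : (forall i, F i.+1 = 0) ->
  \sum_(i \in [set: nat]) F i = F 0%N.
Proof. by move=> F0; rewrite (@nsumE _ 1) ?big_ord1 // => -[]. Qed.

Lemma nsum0 M (F : nat -> M) : (forall i, F i = 0) ->
  \sum_(i \in [set: nat]) F i = 0.
Proof. by move=> F0; rewrite (@nsumE _ 0) ?big_ord0. Qed.

(** The bound [I], uniform in [m], is what makes the bounds of the finitely
    many remaining summands have a maximum. *)
Lemma nsum_truncation M (F : nat -> int -> M) :
  (exists I, forall i m, (I <= i)%N -> F i m = 0) ->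
  (forall i, exists N : int, forall m, N <= m -> F i m = 0) ->
  exists N : int, forall m, N <= m -> \sum_(i \in [set: nat]) F i m = 0.
Proof.
move=> [I FI] Fm.
have [N FN] : exists N : int, forall m, N <= m ->
    forall i, (i < I)%N -> F i m = 0.
  elim: (I) => [|J [N hN]]; first by exists 0.
  have [N' hN'] := Fm J; exists (Num.max N N') => m.
  rewrite ge_max => /andP[h h'] i.
  by rewrite ltnS leq_eqVlt => /predU1P[->|]; [apply: hN' | apply: hN].
exists N => m /FN h; apply: nsum0 => i; case: (ltnP i I) => [/h|/FI] //.
Qed.

Lemma binz0 n : binz n 0 = 1 :> K.
Proof. by rewrite /binz big_ord0 divr1. Qed.

Lemma binz1 n : binz n 1 = n%:~R :> K.
Proof. by rewrite /binz big_ord1 subr0 divr1. Qed.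

Lemma binz0S i : binz 0 i.+1 = 0 :> K.
Proof. by rewrite /binz big_ord_recl subrr mul0r mul0r. Qed.

Lemma binzS n i : binz (n + 1) i.+1 = binz n i.+1 + binz n i :> K.
Proof.
rewrite /binz big_ord_recl big_ord_recr /=.
under eq_bigr => j _.
  have -> : (n + 1)%:~R - (bump 0 j)%:R = n%:~R - j%:R :> K.
    by rewrite /bump leq0n add1n -natr1 intrD; ring.
  over.
have i0 : (i`!)%:R != 0 :> K by rewrite pnatr_eq0 -lt0n fact_gt0.
have i1 : (i.+1%:R : K) != 0 by rewrite pnatr_eq0.
rewrite factS natrM intrD subr0 /=; move: (\prod_(_ < _) _) => P.
by rewrite -natr1 in i1 *; field; rewrite i0.
Qed.

Lemma eventually0Z M (c : nat -> K) (F : nat -> M) :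
  eventually0 F -> eventually0 (fun i => c i *: F i).
Proof. by move=> [N F0]; exists N => i /F0 ->; rewrite scaler0. Qed.

Lemma eventually0S M (F : nat -> M) : eventually0 F -> eventually0 (F \o S).
Proof. by move=> [N F0]; exists N => i iN /=; rewrite F0 // leqW. Qed.

(** When [F i] is the coefficient extraction [f |-> Res z^i f], this is the
    residue of [(1 + z)^n f]. *)
Definition bsum M (n : int) (F : nat -> M) : M :=
  \sum_(i \in [set: nat]) (binz n i : K) *: F i.

Lemma eq_bsum M n (F G : nat -> M) : F =1 G -> bsum n F = bsum n G.
Proof. by move=> /funext ->. Qed.

Lemma bsum_eq0 M n (F : nat -> M) : (forall i, F i = 0) -> bsum n F = 0.
Proof. by move=> F0; apply: nsum0 => i; rewrite F0 scaler0. Qed.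

Lemma bsum0 M (F : nat -> M) : eventually0 F -> bsum 0 F = F 0%N.
Proof.
move=> F0; rewrite /bsum nsumS; last exact: eventually0Z.
by rewrite binz0 scale1r nsum0 ?addr0 // => i; rewrite binz0S scale0r.
Qed.

Lemma bsumS M n (F : nat -> M) : eventually0 F ->
  bsum (n + 1) F = bsum n F + bsum n (F \o S).
Proof.
move=> F0; have F1 := eventually0S F0.
rewrite /bsum [in LHS]nsumS; last exact: eventually0Z.
rewrite [in RHS]nsumS; last exact: eventually0Z.
rewrite !binz0 -addrA; congr (_ + _); rewrite -nsumD; first last.
- exact: eventually0Z.
- exact: (@eventually0Z _ (fun i => binz n i.+1) _ F1).
by apply: eq_fsbigr => i _; rewrite binzS scalerDl.
Qed.

Lemma bsum1 M (F : nat -> M) : eventually0 F -> bsum 1 F = F 0%N + F 1%N.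
Proof.
move=> F0; have F1 := eventually0S F0.
by rewrite -[1]add0r bsumS // !bsum0.
Qed.

Lemma bsum_linear M M' (f : {linear M -> M'}) n (F : nat -> M) :
  eventually0 F -> f (bsum n F) = bsum n (f \o F).
Proof.
move=> F0; rewrite /bsum nsum_linear; last exact: eventually0Z.
by apply: eq_fsbigr => i _; rewrite linearZ.
Qed.

Lemma bsumD M n (F G : nat -> M) : eventually0 F -> eventually0 G ->
  bsum n (F \+ G) = bsum n F + bsum n G.
Proof.
move=> hF hG; rewrite /bsum -nsumD; try exact: eventually0Z.
by apply: eq_fsbigr => i _; rewrite scalerDr.
Qed.

Lemma bsumZ M n c (F : nat -> M) : eventually0 F ->
  bsum n (fun i => c *: F i) = c *: bsum n F.
Proof.
move=> hF; rewrite /bsum nsumZ; last exact: eventually0Z.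
by apply: eq_fsbigr => i _; rewrite !scalerA mulrC.
Qed.

Lemma subspace_bsum M (S : set M) n (F : nat -> M) : subspace S ->
  (forall i, S (F i)) -> S (bsum n F).
Proof. by move=> hS SF; apply: subspace_fsum => // i; apply: subspaceZ. Qed.

(** This reduces identities between residues weighted by [(1 + z)^p z^m] to the
    case [p = 0]. The recurrence is multiplication by [1 + z]. Negative [p] is
    reached by descending induction on [m], starting from the large powers of
    [z], where everything vanishes. *)
Lemma pascal_eq0 M (D : int -> int -> M) :
  (forall p m, D (p + 1) m = D p m + D p (m + 1)) ->
  (forall p, exists N, forall m, N <= m -> D p m = 0) ->
  (forall m, D 0 m = 0) -> forall p m, D p m = 0.
Proof.
move=> DS Dt D0 p; elim/int_rec: p => [//|n IH m|n IH m].
  by rewrite -addn1 PoszD DS !IH addr0.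
have [N DN] := Dt (- n.+1%:Z).
have down k : forall m, N - k%:Z <= m -> D (- n.+1%:Z) m = 0.
  elim: k => [|k IHk] j hj; first by apply: DN; rewrite subr0 in hj.
  have := DS (- n.+1%:Z) j.
  have -> : - n.+1%:Z + 1 = - n%:Z :> int by lia.
  by rewrite IH (IHk (j + 1)) ?addr0; [move=> <- | lia].
by apply: (down `|N - m|%N); lia.
Qed.

End NatSums.

(** * Smeared modes and the smeared Jacobi identity *)

Section SmearedModes.
Context {K : numFieldType} {V : voa K} (M : weak_module V).
Implicit Types (a b : V) (u v : M).

(** The mode as a function of [a], to carry its linearity. *)
Definition mode_of (n : int) (u : M) (a : V) : M := wm_Y M a n u.

HB.instance Definition _ n u :=
  GRing.isLinear.Build K V M *:%R (mode_of n u) (wm_linear n u).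

Lemma modes_eventually0 a k u : eventually0 (fun i => wm_Y M a (i%:Z + k) u).
Proof.
have [N aN] := wm_truncation a u; exists `|N - k|%N => i hi; apply: aN; lia.
Qed.

(** [Res (1 + z)^p z^k Y(a,z) u] *)
Definition smode (p k : int) (a : V) (u : M) : M :=
  bsum p (fun i => wm_Y M a (i%:Z + k) u).

Lemma smode_is_linear p k a : linear (smode p k a).
Proof.
move=> c u v; rewrite /smode -bsumZ; last exact: modes_eventually0.
rewrite -bsumD; last exact: modes_eventually0.
  by apply: eq_bsum => i; rewrite linearP.
exact: (@eventually0Z _ _ (fun=> c) _ (modes_eventually0 _ _ _)).
Qed.

HB.instance Definition _ p k a :=
  GRing.isLinear.Build K M M *:%R (smode p k a) (smode_is_linear p k a).

Definition smode_of (p k : int) (u : M) (a : V) : M := smode p k a u.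

Lemma smode_of_is_linear p k u : linear (smode_of p k u).
Proof.
move=> c a b; rewrite /smode_of /smode -bsumZ; last exact: modes_eventually0.
rewrite -bsumD; last exact: modes_eventually0.
  by apply: eq_bsum => i; rewrite wm_linear.
exact: (@eventually0Z _ _ (fun=> c) _ (modes_eventually0 _ _ _)).
Qed.

HB.instance Definition _ p k u :=
  GRing.isLinear.Build K V M *:%R (smode_of p k u) (smode_of_is_linear p k u).

Lemma eq_smode p p' k k' a a' u :
  p = p' -> k = k' -> a = a' -> smode p k a u = smode p' k' a' u.
Proof. by move=> -> -> ->. Qed.

Lemma smode0l p k u : smode p k 0 u = 0.
Proof. exact: linear0 (smode_of p k u). Qed.

Lemma smode0 k a u : smode 0 k a u = wm_Y M a k u.
Proof. by rewrite /smode bsum0 ?add0r //; apply: modes_eventually0. Qed.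

Lemma smodeS p k a u :
  smode (p + 1) k a u = smode p k a u + smode p (k + 1) a u.
Proof.
rewrite /smode bsumS; last exact: modes_eventually0.
congr (_ + _); apply: eq_bsum => i /=.
by rewrite (_ : i.+1%:Z + k = i%:Z + (k + 1)) //; lia.
Qed.

Lemma smode_truncation a u :
  exists N : int, forall p k, N <= k -> smode p k a u = 0.
Proof.
have [N aN] := wm_truncation a u; exists N => p k Nk.
by apply: bsum_eq0 => i; apply: aN; lia.
Qed.

End SmearedModes.

(** The Jacobi identity tested against
    [(1 + z1)^p (1 + z2)^q z1^m z2^n (z1 - z2)^l]. Both sides obey the same
    Pascal recurrences in [(q, n)] and [(p, m)], and agree for [p = q = 0]. *)
Section SmearedJacobi.
Context {K : numFieldType} {V : voa K} (M : weak_module V).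
Variables (a b : V) (u : M) (l : int).
Implicit Types (p q m n h k Q : int) (i j : nat).

Let c1 (i : nat) : K := (-1) ^+ i * binz l i.
Let c2 (i : nat) : K := (-1) ^ l * (-1) ^+ i * binz l i.

Let left1 p q m n i := c1 i *:
  smode p (l + m - i%:Z) a (smode q (n + i%:Z) b u).
Let left2 p q m n i := c2 i *:
  smode q (l + n - i%:Z) b (smode p (m + i%:Z) a u).
(** [Res z0^h z2^k (1 + z2 + z0)^p (1 + z2)^(Q - p) Y(Y(a,z0)b,z2)u] *)
Let inner p Q h k := bsum p (fun j =>
  smode (Q - j%:Z) k (voa_Y V a (h + j%:Z) b) u).
Let right p q m n :=
  bsum m (fun i => inner p (p + q) (l + i%:Z) (m + n - i%:Z)).

Let left p q m n := \sum_(i \in [set: nat]) left1 p q m n i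
  - \sum_(i \in [set: nat]) left2 p q m n i.

Let left1_ev p q m n : eventually0 (left1 p q m n).
Proof.
have [N bN] := smode_truncation b u; exists `|N - n|%N => i hi.
by rewrite /left1 bN ?linear0 ?scaler0 //; lia.
Qed.

Let left2_ev p q m n : eventually0 (left2 p q m n).
Proof.
have [N aN] := smode_truncation a u; exists `|N - m|%N => i hi.
by rewrite /left2 aN ?linear0 ?scaler0 //; lia.
Qed.

Let Y0 : exists H : int, forall h, H <= h -> voa_Y V a h b = 0.
Proof. exact: voa_truncation. Qed.

Let inner_ev0 Q h k : eventually0 (fun j =>
  smode (Q - j%:Z) k (voa_Y V a (h + j%:Z) b) u : M).
Proof.
have [H YH] := Y0; exists `|H - h|%N => j hj.
by rewrite YH ?smode0l //; lia.
Qed.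

Let inner_eq0 H p Q h k : (forall h, H <= h -> voa_Y V a h b = 0) ->
  H <= h -> inner p Q h k = 0.
Proof.
by move=> YH Hh; apply: bsum_eq0 => j; rewrite YH ?smode0l //; lia.
Qed.

Let inner_trunc p Q h :
  exists N : int, forall k, N <= k -> inner p Q h k = 0.
Proof.
apply: nsum_truncation.
  have [H YH] := Y0; exists `|H - h|%N => i m hi.
  by rewrite YH ?smode0l ?scaler0 //; lia.
move=> i; have [N hN] := smode_truncation (voa_Y V a (h + i%:Z) b) u.
by exists N => m Nm; rewrite hN ?scaler0.
Qed.

Let right_ev p Q h (k : nat -> int) :
  eventually0 (fun i => inner p Q (h + i%:Z) (k i)).
Proof.
have [H YH] := Y0; exists `|H - h|%N => i hi; apply: inner_eq0 YH _; lia.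
Qed.

(** This is [1 + z1 = (1 + z2) + z0], where [z0 = z1 - z2] is the variable of
    [Y(a,z0)b]. *)
Let innerS p Q h k : inner (p + 1) (Q + 1) h k =
  inner p Q h k + inner p Q h (k + 1) + inner p Q (h + 1) k.
Proof.
rewrite /inner bsumS; last exact: inner_ev0.
congr (_ + _).
  rewrite -bsumD; try exact: inner_ev0.
  apply: eq_bsum => j /=; rewrite -smodeS; apply: eq_smode => //; lia.
apply: eq_bsum => j /=; apply: eq_smode => //; first lia.
by rewrite (_ : h + j.+1%:Z = h + 1 + j%:Z) //; lia.
Qed.

Let rightS p q m n : right (p + 1) q m n = right p q m n + right p q (m + 1) n.
Proof.
rewrite [right p q (m + 1) n]/right bsumS; last exact: right_ev.
have ev1 : eventually0 (fun i => inner p (p + q) (l + i%:Z) (m + n - i%:Z)).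
  exact: right_ev.
have ev2 : eventually0 (fun i => inner p (p + q) (l + i%:Z) (m + 1 + n - i%:Z)).
  exact: right_ev.
have ev3 := eventually0S ev2.
rewrite addrA -(bsumD _ ev1 ev2) -bsumD //; last first.
  have [N h] := eventually0D ev1 ev2.
  by exists N => i /h[/= -> ->]; rewrite addr0.
apply: eq_bsum => i /=.
rewrite (_ : p + 1 + q = p + q + 1) ?innerS; last by lia.
rewrite (_ : m + 1 + n - i%:Z = m + n - i%:Z + 1); last by lia.
rewrite (_ : m + 1 + n - i.+1%:Z = m + n - i%:Z); last by lia.
by rewrite (_ : l + i.+1%:Z = l + i%:Z + 1) //; lia.
Qed.

Let leftS p q m n : left (p + 1) q m n = left p q m n + left p q (m + 1) n.
Proof.
rewrite /left addrACA -opprD -!nsumD //.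
congr (_ - _); apply: eq_fsbigr => i _; rewrite /left1 /left2.
  rewrite smodeS scalerDr.
  by rewrite (_ : l + (m + 1) - i%:Z = l + m - i%:Z + 1) //; lia.
by rewrite smodeS linearD scalerDr (_ : m + 1 + i%:Z = m + i%:Z + 1) //; lia.
Qed.

Let left_trunc p q n : exists N : int, forall m, N <= m -> left p q m n = 0.
Proof.
have [N1 h1] : exists N : int, forall m, N <= m ->
    \sum_(i \in [set: nat]) left1 p q m n i = 0.
  apply: (@nsum_truncation _ _ (fun i m => left1 p q m n i)).
    have [N bN] := smode_truncation b u; exists `|N - n|%N => i m hi.
    by rewrite /left1 bN ?linear0 ?scaler0 //; lia.
  move=> i; have [N hN] := smode_truncation a (smode q (n + i%:Z) b u).
  by exists (N - l + i%:Z) => m Nm; rewrite /left1 hN ?scaler0 //; lia.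
have [N2 h2] := smode_truncation a u.
exists (Num.max N1 N2) => m; rewrite ge_max => /andP[m1 m2].
rewrite /left h1 // nsum0 ?subr0 // => i.
by rewrite /left2 h2 ?linear0 ?scaler0 //; lia.
Qed.

Let right_trunc p q n : exists N : int, forall m, N <= m -> right p q m n = 0.
Proof.
apply: nsum_truncation.
  have [H YH] := Y0; exists `|H - l|%N => i m hi.
  by rewrite (inner_eq0 _ _ _ YH) ?scaler0 //; lia.
move=> i; have [N hN] := inner_trunc p (p + q) (l + i%:Z).
by exists (N - n + i%:Z) => m Nm; rewrite hN ?scaler0 //; lia.
Qed.

Let leftSq p q m n : left p (q + 1) m n = left p q m n + left p q m (n + 1).
Proof.
rewrite /left addrACA -opprD -!nsumD //.
congr (_ - _); apply: eq_fsbigr => i _; rewrite /left1 /left2.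
  by rewrite smodeS linearD scalerDr (_ : n + 1 + i%:Z = n + i%:Z + 1) //; lia.
by rewrite smodeS scalerDr (_ : l + (n + 1) - i%:Z = l + n - i%:Z + 1) //; lia.
Qed.

Let rightSq q m n : right 0 (q + 1) m n = right 0 q m n + right 0 q m (n + 1).
Proof.
rewrite /right -bsumD; [ | exact: right_ev | exact: right_ev].
apply: eq_bsum => i /=; rewrite /inner !(bsum0 (inner_ev0 _ _ _)).
rewrite (_ : 0 + (q + 1) - 0%:Z = 0 + q - 0%:Z + 1) ?smodeS; last by lia.
by rewrite (_ : m + (n + 1) - i%:Z = m + n - i%:Z + 1) //; lia.
Qed.

Let left_truncq q m : exists N : int, forall n, N <= n -> left 0 q m n = 0.
Proof.
have [N1 h1] : exists N : int, forall n, N <= n ->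
    \sum_(i \in [set: nat]) left2 0 q m n i = 0.
  apply: (@nsum_truncation _ _ (fun i n => left2 0 q m n i)).
    have [N aN] := smode_truncation a u; exists `|N - m|%N => i n hi.
    by rewrite /left2 aN ?linear0 ?scaler0 //; lia.
  move=> i; have [N hN] := smode_truncation b (smode 0 (m + i%:Z) a u).
  by exists (N - l + i%:Z) => n Nn; rewrite /left2 hN ?scaler0 //; lia.
have [N2 h2] := smode_truncation b u.
exists (Num.max N1 N2) => n; rewrite ge_max => /andP[n1 n2].
rewrite /left h1 // nsum0 ?subr0 // => i.
by rewrite /left1 h2 ?linear0 ?scaler0 //; lia.
Qed.

Let right_truncq q m : exists N : int, forall n, N <= n -> right 0 q m n = 0.
Proof.
apply: nsum_truncation.
  have [H YH] := Y0; exists `|H - l|%N => i n hi.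
  by rewrite (inner_eq0 _ _ _ YH) ?scaler0 //; lia.
move=> i; have [N hN] := inner_trunc 0 (0 + q) (l + i%:Z).
by exists (N - m + i%:Z) => n Nn; rewrite hN ?scaler0 //; lia.
Qed.

Let left_right00 m n : left 0 0 m n = right 0 0 m n.
Proof.
transitivity (bsum m (fun i =>
  wm_Y M (voa_Y V a (l + i%:Z) b) (m + n - i%:Z) u)).
  rewrite /bsum -wm_jacobi; congr (_ - _); apply: eq_fsbigr => i _.
    by rewrite /left1 !smode0.
  by rewrite /left2 !smode0.
apply: eq_bsum => i; rewrite /inner (bsum0 (inner_ev0 _ _ _)).
by rewrite (_ : 0 + 0 - 0%:Z = 0) // smode0 addr0.
Qed.

Let left_right0 q m n : left 0 q m n = right 0 q m n.
Proof.
apply/eqP; rewrite -subr_eq0; apply/eqP.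
apply: (pascal_eq0 (D := fun q n => left 0 q m n - right 0 q m n)).
- by move=> q' n'; rewrite leftSq rightSq opprD addrACA.
- move=> q'; have [N1 h1] := left_truncq q' m.
  have [N2 h2] := right_truncq q' m.
  exists (Num.max N1 N2) => n'.
  by rewrite ge_max => /andP[/h1-> /h2->]; rewrite subr0.
- by move=> n'; rewrite left_right00 subrr.
Qed.

Theorem smeared_jacobi p q m n :
  \sum_(i \in [set: nat]) ((-1) ^+ i * binz l i) *:
     smode p (l + m - i%:Z) a (smode q (n + i%:Z) b u)
  - \sum_(i \in [set: nat]) ((-1) ^ l * (-1) ^+ i * binz l i) *:
     smode q (l + n - i%:Z) b (smode p (m + i%:Z) a u)
  = bsum m (fun i => bsum p (fun j =>
     smode (p + q - j%:Z) (m + n - i%:Z) (voa_Y V a (l + i%:Z + j%:Z) b) u)).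
Proof.
rewrite -/(left p q m n) -/(right p q m n).
apply/eqP; rewrite -subr_eq0; apply/eqP.
apply: (pascal_eq0 (D := fun p m => left p q m n - right p q m n)).
- by move=> p' m'; rewrite leftS rightS opprD addrACA.
- move=> p'; have [N1 h1] := left_trunc p' q n.
  have [N2 h2] := right_trunc p' q n.
  exists (Num.max N1 N2) => m'.
  by rewrite ge_max => /andP[/h1-> /h2->]; rewrite subr0.
- by move=> m'; rewrite left_right0 subrr.
Qed.

End SmearedJacobi.

(** * Extending linear maps from the summands of a direct sum *)

Section DirectSum.
Context {K : fieldType} {I : choiceType}.

Definition finitely_supported (M : lmodType K) (f : I -> M) : Prop :=
  finite_set [set i | f i != 0].

Lemma fsumE (M : lmodType K) (A : {fset I}) (f : I -> M) :
  [set i | f i != 0] `<=` [set` A] ->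
  \sum_(i \in [set: I]) f i = \sum_(i <- A) f i.
Proof.
move=> fA; apply: fsbigTE => i iA; apply/eqP; apply: contraNT iA => fi.
exact: fA.
Qed.

Lemma fsum_linear (M X : lmodType K) c (f g : I -> M)
    (G : I -> {linear M -> X}) :
  finitely_supported f -> finitely_supported g ->
  \sum_(i \in [set: I]) G i (c *: f i + g i) =
  c *: \sum_(i \in [set: I]) G i (f i) + \sum_(i \in [set: I]) G i (g i).
Proof.
move=> ff fg; pose A := fset_set ([set i | f i != 0] `|` [set i | g i != 0]).
have inA i : i \in A <-> f i != 0 \/ g i != 0.
  rewrite in_fset_set ?finite_setU //; split=> [/set_mem//|?]; exact/mem_set.
have Gsupp h : (forall i, h i != 0 -> i \in A) ->
    [set i | G i (h i) != 0] `<=` [set` A].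
  move=> hA i /= Gh; apply: hA; by apply: contra_neq Gh => ->; rewrite linear0.
rewrite !(@fsumE X A).
- rewrite scaler_sumr -big_split; apply: eq_bigr => i _; exact: linearP.
- by apply: Gsupp => i gi; apply/inA; right.
- by apply: Gsupp => i fi; apply/inA; left.
apply: (Gsupp (fun i => c *: f i + g i)) => i fgi; apply/inA.
case: (eqVneq (f i) 0) => fi; last by left.
by right; apply: contra_neq fgi => ->; rewrite fi scaler0 addr0.
Qed.

Variables (M : lmodType K) (E : I -> set M).
Hypotheses (E_sub : forall i, subspace (E i)) (hE : direct_sum E).

Lemma componentP m : [/\ forall i, E i (component hE m i),
  finitely_supported (component hE m) &
  m = \sum_(i \in [set: I]) component hE m i].
Proof. by rewrite /component; case: cid => f /= fP; have [[]] := fP. Qed.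

Lemma component_unique m f : (forall i, E i (f i)) -> finitely_supported f ->
  m = \sum_(i \in [set: I]) f i -> component hE m = f.
Proof.
by move=> Ef ff mf; rewrite /component; case: cid => g /= gP; apply: gP.2.
Qed.

Lemma component_linear c x y :
  component hE (c *: x + y) = fun i => c *: component hE x i + component hE y i.
Proof.
have [Ex fx sx] := componentP x; have [Ey fy sy] := componentP y.
apply: component_unique.
- by move=> i; apply: subspaceD => //; apply: subspaceZ.
- apply: (@sub_finite_set _ _ ([set i | component hE x i != 0] `|`
    [set i | component hE y i != 0])); last by rewrite finite_setU.
  move=> i /= h; case: (eqVneq (component hE x i) 0) => xi; last by left.
  by right; apply: contra_neq h => ->; rewrite xi scaler0 addr0.
- by rewrite {1}sx {1}sy (fsum_linear c (fun=> idfun : {linear M -> M}) fx fy).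
Qed.

Lemma component_in i m : E i m ->
  component hE m = fun j => if j == i then m else 0.
Proof.
have supp : [set j | (if j == i then m else 0) != 0] `<=` [set` [fset i]%fset].
  by move=> j /=; rewrite inE; case: (j =P i); rewrite ?eqxx.
move=> Em; apply: component_unique.
- by move=> j; case: eqP => [->|_] //; apply: subspace0.
- exact: sub_finite_set supp (finite_fset _).
- by rewrite (fsumE supp) big_seq_fset1 eqxx.
Qed.

Lemma direct_sum_ind (S : set M) : subspace S ->
  (forall i, E i `<=` S) -> forall m, S m.
Proof.
move=> hS ES m; have [Em _ ->] := componentP m.
by apply: subspace_fsum => // i; apply: ES.
Qed.

(** Weight-dependent formulas such as [a * b] and [o(a)] are given on each
    homogeneous component by a linear map [G i]. *)
Section Extension.
Variables (X : lmodType K) (G : I -> {linear M -> X}).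

Definition extend (m : M) : X := \sum_(i \in [set: I]) G i (component hE m i).

Lemma extend_is_linear : linear extend.
Proof.
move=> c x y; rewrite /extend component_linear.
have [_ fx _] := componentP x; have [_ fy _] := componentP y.
exact: fsum_linear.
Qed.

HB.instance Definition _ :=
  GRing.isLinear.Build K M X *:%R extend extend_is_linear.

Lemma extendE i m : E i m -> extend m = G i m.
Proof.
move=> Em; rewrite /extend (component_in Em) (@fsumE _ [fset i]%fset).
  by rewrite big_seq_fset1 eqxx.
by move=> j /=; rewrite inE; case: (j =P i); rewrite ?linear0 ?eqxx.
Qed.

End Extension.
End DirectSum.

(** * Weights and modes of the conformal vector *)

Section Commutators.
Context {K : numFieldType} {V : voa K} (M : weak_module V).
Implicit Types (a b : V) (u : M).

(** With [l = 0] the two series on the left of the Jacobi identity reduce to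
    their first terms. *)
Lemma smeared_commutator p m q n a b u :
  smode p m a (smode q n b u) - smode q n b (smode p m a u) =
  bsum m (fun i => bsum p (fun j =>
    smode (p + q - j%:Z) (m + n - i%:Z) (voa_Y V a (i%:Z + j%:Z) b) u)).
Proof.
have := smeared_jacobi a b u 0 p q m n.
rewrite nsum_head; last by move=> i; rewrite binz0S mulr0 scale0r.
rewrite nsum_head; last by move=> i; rewrite binz0S mulr0 scale0r.
rewrite binz0 !mulr1 !expr0 ?mulr1 !scale1r.
rewrite (_ : 0%:Z = 0) // !add0r !subr0 => ->.
by apply: eq_bsum => i; apply: eq_bsum => j; rewrite add0r.
Qed.

Lemma mode_commutator m n a b u :
  wm_Y M a m (wm_Y M b n u) - wm_Y M b n (wm_Y M a m u) =
  bsum m (fun i => wm_Y M (voa_Y V a i%:Z b) (m + n - i%:Z) u).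
Proof.
have := wm_jacobi a b u 0 m n.
rewrite nsum_head; last by move=> i; rewrite binz0S mulr0 scale0r.
rewrite nsum_head; last by move=> i; rewrite binz0S mulr0 scale0r.
rewrite binz0 !mulr1 !expr0 ?mulr1 !scale1r.
rewrite (_ : 0%:Z = 0) // !add0r !subr0 => ->.
by apply: eq_fsbigr => i _; rewrite add0r.
Qed.

Lemma wm_Y0l n u : wm_Y M 0 n u = 0.
Proof. exact: linear0 (mode_of n u). Qed.

Lemma wm_YZl n c a u : wm_Y M (c *: a) n u = c *: wm_Y M a n u.
Proof. exact: (linearZ_LR (mode_of n u)). Qed.

(** The vertex operator of [L(-1)a = a(-2)1] is the derivative of that of [a];
    the Jacobi identity against the vacuum reduces to finitely many terms. *)
Lemma wm_derivative a n u :
  wm_Y M (voa_L V (-1) a) n u = - n%:~R *: wm_Y M a (n - 1) u.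
Proof.
have L1a : voa_L V (-1) a = voa_Y V a (-2) (voa_one V).
  have := voa_derivative a (-1) (voa_one V).
  by rewrite voa_creation //= => ->; rewrite opprK scale1r.
have := wm_jacobi a (voa_one V) u (-2) (n + 1) (-1).
rewrite (@nsumE _ _ 1); last first.
  by move=> i i0; rewrite wm_vacuum ifF ?linear0 ?scaler0 //; lia.
rewrite nsum0; last first.
  by move=> i; rewrite wm_vacuum ifF ?scaler0 //; lia.
rewrite (@nsumE _ _ 2); last first.
  move=> i i0; rewrite voa_creation; last by lia.
  by rewrite ifF ?wm_Y0l ?scaler0 //; lia.
rewrite !big_ord_recr !big_ord0 /= !add0r !subr0.
rewrite expr0 mul1r !binz0 binz1 !scale1r.
rewrite (_ : -2 + 1%:Z = -1) // (_ : n + 1 - 1 = n) ?addrK //.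
rewrite wm_vacuum (@voa_creation _ V a (-1)) //= -L1a.
rewrite (_ : -2 + (n + 1) = n - 1); last by lia.
move=> e; apply: (addIr ((n + 1)%:~R *: wm_Y M a (n - 1) u)).
by rewrite -e -scalerDl intrD addKr scale1r.
Qed.

(** By the commutator formula, [[L(0), a(n)] = (L(-1)a)(n + 1) + (L(0)a)(n)]. *)
Lemma L0_mode k a n u : voa_wt V k a ->
  wm_L M 0 (wm_Y M a n u) =
  wm_Y M a n (wm_L M 0 u) + (k - n - 1)%:~R *: wm_Y M a n u.
Proof.
move=> ka; apply/eqP; rewrite addrC -subr_eq; apply/eqP.
rewrite /wm_L add0r mode_commutator bsum1; last first.
  have [N hN] := voa_truncation (voa_omega V) a; exists `|N|%N => i hi.
  by rewrite hN ?wm_Y0l //; lia.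
rewrite (_ : 1 + n - 0%:Z = n + 1) 1?(_ : 1 + n - 1%:Z = n); try lia.
have -> : voa_Y V (voa_omega V) 0%:Z a = voa_L V (-1) a by [].
have -> : voa_Y V (voa_omega V) 1%:Z a = k%:~R *: a by rewrite -ka.
rewrite wm_derivative addrK wm_YZl -scalerDl; congr (_ *: _).
by rewrite !intrD !intrN; ring.
Qed.

End Commutators.

(** * The ideal O(V) *)

Section SmodeDerivative.
Context {K : numFieldType} {V : voa K} (M : weak_module V).

Lemma binz_absorb p i : i.+1%:R * binz p i.+1 = p%:~R * binz (p - 1) i :> K.
Proof.
rewrite /binz big_ord_recl subr0 /=.
under eq_bigr => j _.
  have -> : p%:~R - (bump 0 j)%:R = (p - 1)%:~R - j%:R :> K.
    by rewrite /bump leq0n add1n -natr1 intrB; ring.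
  over.
have i0 : (i`!)%:R != 0 :> K by rewrite pnatr_eq0 -lt0n fact_gt0.
have i1 : (i.+1%:R : K) != 0 by rewrite pnatr_eq0.
rewrite factS natrM; move: (\prod_(_ < _) _) => P.
by rewrite -natr1 in i1 *; field; rewrite i0.
Qed.

(** Integration by parts, since [Y(L(-1)a,z)] is the derivative of [Y(a,z)]. *)
Lemma smode_derivative p k (a : V) (u : M) : smode p k (voa_L V (-1) a) u =
  - (p%:~R *: smode (p - 1) k a u + k%:~R *: smode p (k - 1) a u).
Proof.
pose A i := wm_Y M a (i%:Z + (k - 1)) u.
pose iA i := (i%:R : K) *: A i; pose kA i := (k%:~R : K) *: A i.
have evA : eventually0 A by exact: modes_eventually0.
have eviA : eventually0 iA by exact: (@eventually0Z _ _ (fun i => i%:R) _ evA).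
have evkA : eventually0 kA by exact: (@eventually0Z _ _ (fun=> k%:~R) _ evA).
have -> : smode p k (voa_L V (-1) a) u = bsum p (fun i => (-1) *: (iA \+ kA) i).
  apply: eq_bsum => i; rewrite wm_derivative /= /iA /kA.
  by rewrite -scalerDl scalerA mulN1r intrD /A addrA.
rewrite bsumZ; last by have [N h] := eventually0D eviA evkA;
  exists N => i /h [/= -> ->]; rewrite addr0.
rewrite scaleN1r bsumD // [bsum p kA]bsumZ //; congr (- (_ + _)).
rewrite /bsum nsumS; last exact: eventually0Z.
rewrite /iA scale0r scaler0 add0r -bsumZ; last exact: modes_eventually0.
apply: eq_fsbigr => i _; rewrite !scalerA mulrC binz_absorb mulrC.
by rewrite /A (_ : i.+1%:Z + (k - 1) = i%:Z + k) //; lia.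
Qed.

End SmodeDerivative.

Section ZhuIdeal.
Context {K : numFieldType} (V : voa K).
Implicit Types (a b c : V).

Definition adjoint : weak_module V :=
  WeakModule (@voa_linear K V) (@voa_truncation K V) (@voa_vacuum K V)
    (@voa_jacobi K V).

Local Notation res := (@smode K V adjoint).
Local Notation O := (@zhu_O K V).

Lemma voa_wt_subspace n : subspace (voa_wt V n).
Proof.
apply: subspaceP => [|c x y]; rewrite /voa_wt /=.
  by rewrite linear0 scaler0.
move=> xn yn; rewrite linearP [voa_L V 0 x]xn [voa_L V 0 y]yn.
by rewrite scalerDr !scalerA mulrC.
Qed.

Lemma zhu_O_subspace : subspace O.
Proof. exact: zhu_O_submod_closed. Qed.

Lemma wt_mode k l n a b : voa_wt V k a -> voa_wt V l b ->
  voa_wt V (k + l - n - 1) (voa_Y V a n b).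
Proof.
move=> ka lb; have L0b : wm_L adjoint 0 b = l%:~R *: b by [].
have := @L0_mode K V adjoint k a n b ka.
rewrite L0b linearZ -scalerDl => L0ab; apply: etrans L0ab _.
by congr (_ *: _); rewrite !intrD !intrN /=; ring.
Qed.

(** [O(V)] contains all residues of [Y(a,z)b] whose pole at [z = 0] is large
    enough compared with the exponent of [1 + z]: applying the defining relation
    to [L(-1)a] raises the order of the pole. *)
Lemma zhu_O_res w a b (n m : nat) : voa_wt V w a -> (n <= m)%N ->
  O (res (w + n%:Z) (-2 - m%:Z) a b).
Proof.
have O_sub := zhu_O_subspace.
move=> wa; elim: n m => [|n IHn] m nm; last first.
  rewrite (_ : w + n.+1%:Z = w + n%:Z + 1) ?smodeS; last by lia.
  apply: (subspaceD O_sub); first by apply: IHn; lia.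
  by rewrite (_ : -2 - m%:Z + 1 = -2 - m.-1%:Z); [apply: IHn | ]; lia.
rewrite addr0; elim: m a w wa {nm} => [|m IHm] a w wa.
  exists 1%N, (fun=> 1), (fun=> zhu_res w 2 a b); rewrite big_ord1 scale1r.
  by split=> // _; exists w, a, b.
have La : voa_wt V (w + 1) (voa_L V (-1) a).
  rewrite (_ : w + 1 = 2 + w - 0 - 1); last by lia.
  by apply: wt_mode wa; apply: voa_wt_omega.
have := IHm _ _ La.
rewrite smode_derivative addrK.
rewrite (_ : -2 - m%:Z - 1 = -2 - m.+1%:Z) ?smodeS; last by lia.
rewrite (_ : -2 - m.+1%:Z + 1 = -2 - m%:Z); last by lia.
set x := res w (-2 - m.+1%:Z) a b; set y := res w (-2 - m%:Z) a b.
have Oy : O y by apply: IHm.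
set z := - _ => Oz.
have m2 : (m.+2%:R : K) != 0 by rewrite pnatr_eq0.
have -> : x = m.+2%:R^-1 *: (z + ((w + 1) + (-2 - m%:Z))%:~R *: y).
  apply: (scalerI m2); rewrite scalerA divff // scale1r /z.
  rewrite scalerDr addrCA opprD -scalerDl -intrD subrK -scaleNr -intrN.
  by rewrite -[m.+2%:R]/(m.+2%:Z%:~R); congr (_%:~R *: _); lia.
by apply: subspaceZ => //; apply: subspaceD => //; apply: subspaceZ.
Qed.

(** The second argument of the generators may also be taken homogeneous. *)
Lemma zhu_O_ind (S : set V) : subspace S ->
  (forall k l a b, voa_wt V k a -> voa_wt V l b -> S (res k (-2) a b)) ->
  O `<=` S.
Proof.
move=> S_sub SO _ [n [c [v [vO ->]]]]; apply: subspace_sum => // i.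
apply: subspaceZ => //; have [k [a [b [ka ->]]]] := vO i.
rewrite -[zhu_res _ _ _ _]/(res k (-2) a b); move: b.
apply: (direct_sum_ind (voa_grading V)) => [|l b lb]; last first.
  exact: (SO k l a b ka lb).
apply: subspaceP => [|d x y Sx Sy]; first by rewrite linear0; apply: subspace0.
by rewrite linearP; apply: subspaceD => //; apply: subspaceZ.
Qed.

Lemma zhu_star_linearl x : linear (fun a : V => zhu_star a x : V).
Proof.
exact: (extend_is_linear voa_wt_subspace (voa_grading V)
  (fun n => (@smode_of K V adjoint n (-1) x : {linear V -> adjoint}))).
Qed.

Definition star_on (x a : V) : V := zhu_star a x.

HB.instance Definition _ x :=
  GRing.isLinear.Build K V V *:%R (star_on x) (zhu_star_linearl x).

Lemma zhu_star0l (x : V) : zhu_star 0 x = 0.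
Proof. exact: linear0 (star_on x). Qed.

Lemma zhu_starPl (x : V) (d : K) a b :
  zhu_star (d *: a + b) x = d *: zhu_star a x + zhu_star b x.
Proof. exact: linearP (star_on x) _ _ _. Qed.

Lemma zhu_starE k a x : voa_wt V k a -> zhu_star a x = res k (-1) a x.
Proof.
move=> ka; exact: (extendE voa_wt_subspace (voa_grading V)
  (fun n => (@smode_of K V adjoint n (-1) x : {linear V -> adjoint})) ka).
Qed.

Lemma zhu_star_linear a : linear (zhu_star a).
Proof.
move=> c x y; apply/eqP; rewrite -subr_eq0; apply/eqP; move: a.
apply: (direct_sum_ind (voa_grading V)) => [|k a ka]; last first.
  by rewrite !(zhu_starE _ ka) linearP subrr.
pose f : {linear V -> V} :=
  star_on (c *: x + y) \- (c \*: star_on x \+ star_on y).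
apply: (@subspaceP _ _ (fun a => f a = 0)) => [|d a b fa fb].
  exact: linear0.
by rewrite linearP fa fb scaler0 addr0.
Qed.

HB.instance Definition _ a :=
  GRing.isLinear.Build K V V *:%R (zhu_star a) (zhu_star_linear a).

Lemma zhu_O_res_eq w p q (n m : nat) a b :
  voa_wt V w a -> p = w + n%:Z -> q = -2 - m%:Z -> (n <= m)%N ->
  O (res p q a b).
Proof. by move=> wa -> ->; apply: zhu_O_res. Qed.

Lemma voa_modes_eventually0 a b h :
  exists N : nat, forall i, (N <= i)%N -> voa_Y V a (h + i%:Z) b = 0.
Proof.
by have [N hN] := voa_truncation a b; exists `|N - h|%N => i hi; apply: hN; lia.
Qed.

(** The commutator of [a * -] with [b o -] is a sum of residues of [Y(d,z)c]
    with exponent [wt d + i + 1] of [1 + z] and a pole of order [i + 3]. *)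
Lemma zhu_starO a x : O x -> O (zhu_star a x).
Proof.
move=> Ox; move: a; have O_sub := zhu_O_subspace.
apply: (direct_sum_ind (voa_grading V)) => [|w a wa].
  apply: subspaceP; first by rewrite zhu_star0l; apply: subspace0.
  move=> c a b Oa Ob; rewrite zhu_starPl.
  by apply: subspaceD => //; apply: subspaceZ.
move: x Ox; apply: zhu_O_ind => [|k l b c kb lc].
  apply: subspaceP; first by rewrite linear0; apply: subspace0.
  move=> d y z Oy Oz; rewrite linearP.
  by apply: subspaceD => //; apply: subspaceZ.
rewrite (zhu_starE _ wa).
rewrite -[X in O X](subrK (res k (-2) b (res w (-1) a c))) smeared_commutator.
apply: subspaceD => //; last by apply: (zhu_O_res_eq _ kb _ _ (leqnn 0)); lia.
apply: subspace_bsum => // i; apply: subspace_bsum => // j.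
have wab : voa_wt V (w + k - (i%:Z + j%:Z) - 1) (voa_Y V a (i%:Z + j%:Z) b).
  exact: wt_mode.
by apply: (zhu_O_res_eq _ wab _ _ (leqnn i.+1)); lia.
Qed.

(** The Jacobi identity turns [(a o b) * c] into products in which the leftmost
    operator is [Y(a,z)] or [Y(b,z)] with a pole of order at least 2. *)
Lemma zhu_star_Ol x c : O x -> O (zhu_star x c).
Proof.
have O_sub := zhu_O_subspace; move: x; apply: zhu_O_ind => [|k l a b ka lb].
  apply: subspaceP; first by rewrite zhu_star0l; apply: subspace0.
  move=> d a b Oa Ob; rewrite zhu_starPl.
  by apply: subspaceD => //; apply: subspaceZ.
rewrite -/(star_on c _) /smode bsum_linear; last first.
  exact: (@modes_eventually0 _ _ adjoint).
(* [wt (a(j - 2)b) = k + l - j + 1], so [(a o b) * c] is the right-hand side of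
   the Jacobi identity weighted by [(1 + z1)^k (1 + z2)^(l + 1)], at [(l, m, n)]
   equal to [(-2, 0, -1)]. *)
have -> : bsum k (star_on c \o (fun i : nat => voa_Y V a (i%:Z + -2) b)) =
    bsum 0 (fun i => bsum k (fun j =>
      res (k + (l + 1) - j%:Z) (0 + (-1) - i%:Z)
        (voa_Y V a (-2 + i%:Z + j%:Z) b) c)).
  rewrite bsum0.
    apply: eq_bsum => j /=; rewrite /star_on.
    rewrite (zhu_starE _ (wt_mode _ ka lb)).
    apply: (@eq_smode _ _ adjoint); [lia | lia |].
    by rewrite (_ : j%:Z + -2 = -2 + 0%:Z + j%:Z) //; lia.
  have [N hN] := voa_modes_eventually0 a b (-2); exists N => i hi.
  apply: bsum_eq0 => j; rewrite (_ : -2 + i%:Z + j%:Z = -2 + (i + j)%:Z).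
    by rewrite hN ?smode0l //; lia.
  by lia.
rewrite -smeared_jacobi; apply: subspaceB => //.
  apply: subspace_fsum => // i; apply: subspaceZ => //.
  by apply: (zhu_O_res_eq _ ka _ _ (leq0n i)); lia.
apply: subspace_fsum => // i; apply: subspaceZ => //.
by apply: (zhu_O_res_eq (m := i.+1) (n := 1%N) _ lb); lia.
Qed.

Let omega := voa_omega V.

(** For homogeneous [a] this is [a o 1]. *)
Lemma zhu_O_Lm1_L0 a : O (voa_L V (-1) a + voa_L V 0 a).
Proof.
have O_sub := zhu_O_subspace; move: a.
apply: (direct_sum_ind (voa_grading V)) => [|k a ka].
  apply: subspaceP => [|d x y Ox Oy].
    by rewrite !linear0 addr0; apply: subspace0.
  rewrite !linearP addrACA -scalerDr; apply: subspaceD => //; exact: subspaceZ.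
have <- : res k (-2) a (voa_one V) = voa_L V (-1) a + voa_L V 0 a; last first.
  by apply: (zhu_O_res_eq (n := 0) (m := 0) _ ka); lia.
rewrite /smode /bsum (@nsumE _ _ 2) => [|i i2]; last first.
  rewrite /= voa_creation; last by lia.
  by rewrite ifF ?scaler0 //; lia.
rewrite !big_ord_recl big_ord0 addr0 binz0 scale1r binz1; congr (_ + _).
  have := voa_derivative a (-1) (voa_one V).
  by rewrite voa_creation //= opprK scale1r => ->.
rewrite [RHS]ka; congr (_ *: _); exact: (voa_creation a (n := -1)).
Qed.

(** The conformal vector is central in Zhu's algebra: modulo [O(V)] its left
    multiplication is [L(-2) + L(-1)], whose commutator with [b * -] is a sum of
    residues with poles of high order. *)
Lemma zhu_star_omega_comm a x :
  O (zhu_star omega (zhu_star a x) - zhu_star a (zhu_star omega x)).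
Proof.
have O_sub := zhu_O_subspace.
have omega2 : voa_wt V 2 omega by apply: voa_wt_omega.
pose rho := res 1 (-1) omega.
have rhoE y : O (zhu_star omega y - rho y).
  rewrite (zhu_starE _ omega2) (_ : 2 = 1 + 1) // smodeS addrC addKr.
  rewrite /smode bsum1; last exact: (@modes_eventually0 _ _ adjoint).
  exact: zhu_O_Lm1_L0.
have comm k b y : voa_wt V k b ->
    O (rho (res k (-1) b y) - res k (-1) b (rho y)).
  move=> kb; rewrite smeared_commutator.
  apply: subspace_bsum => // i; apply: subspace_bsum => // j.
  (* The weight of [omega(i + j)b] is [k + 1 - i - j], so that the exponent
     [1 + k - j] of [1 + z] exceeds it by [i]; the pole has order [2 + i]. *)
  have wob := wt_mode (i%:Z + j%:Z) omega2 kb.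
  by apply: (zhu_O_res_eq _ wob _ _ (leqnn i)); lia.
move: a; apply: (direct_sum_ind (voa_grading V)) => [|k a ka].
  apply: subspaceP => [|d a b Oa Ob].
    by rewrite !zhu_star0l linear0 subr0; apply: subspace0.
  rewrite !zhu_starPl linearP opprD addrACA -scalerBr.
  by apply: subspaceD => //; apply: subspaceZ.
rewrite -(subrKA (rho (zhu_star a x))); apply: subspaceD => //.
rewrite !(zhu_starE _ ka) -(subrKA (res k (-1) a (rho x))).
apply: subspaceD => //; first exact: comm.
have : O (rho x - zhu_star omega x).
  by rewrite -opprB -scaleN1r; apply: subspaceZ.
by move=> /(zhu_starO a); rewrite (zhu_starE _ ka) linearB.
Qed.

End ZhuIdeal.

(** * Vectors annihilated by a polynomial in an operator *)

Section PolynomialOperator.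
Context {K : fieldType} {M : lmodType K} (T : {linear M -> M}).
Implicit Types (p q : {poly K}) (u v : M).

Definition polyop p u : M := \sum_(i < size p) p`_i *: iter i T u.

Lemma polyopE N p u : (size p <= N)%N ->
  polyop p u = \sum_(i < N) p`_i *: iter i T u.
Proof.
move=> pN; rewrite /polyop (big_ord_widen _ (fun i => p`_i *: iter i T u) pN).
rewrite big_mkcond; apply: eq_bigr => i _; case: ltnP => // ip.
by rewrite nth_default // scale0r.
Qed.

Lemma iter_linear i : linear (iter i T).
Proof. by elim: i => [|i IH] c u v //=; rewrite IH linearP. Qed.

HB.instance Definition _ i :=
  GRing.isLinear.Build K M M *:%R (iter i T) (iter_linear i).

Lemma polyop_is_linear p : linear (polyop p).
Proof.
move=> c u v; rewrite /polyop scaler_sumr -big_split; apply: eq_bigr => i _.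
by rewrite linearP scalerDr !scalerA mulrC.
Qed.

HB.instance Definition _ p :=
  GRing.isLinear.Build K M M *:%R (polyop p) (polyop_is_linear p).

Lemma polyop_linearl u : linear (polyop^~ u).
Proof.
move=> c p q; pose N := maxn (size p) (size q).
have pN : (size p <= N)%N by rewrite leq_maxl.
have qN : (size q <= N)%N by rewrite leq_maxr.
rewrite !(@polyopE N) //; last first.
  rewrite (leq_trans (size_polyD _ _)) // geq_max qN andbT.
  exact: leq_trans (size_scale_leq _ _) pN.
rewrite scaler_sumr -big_split; apply: eq_bigr => i _ /=.
by rewrite coefD coefZ scalerDl scalerA.
Qed.

Definition polyop_at u p := polyop p u.

HB.instance Definition _ u :=
  GRing.isLinear.Build K {poly K} M *:%R (polyop_at u) (polyop_linearl u).

Lemma polyopC c u : polyop c%:P u = c *: u.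
Proof. by rewrite (@polyopE 1) ?size_polyC_leq1 // big_ord1 coefC. Qed.

Lemma polyopXM p u : polyop ('X * p) u = T (polyop p u).
Proof.
rewrite (@polyopE (size p).+1); last first.
  by rewrite mulrC (leq_trans (size_polyMleq _ _)) // size_polyX addn2.
rewrite big_ord_recl coefXM scale0r add0r linear_sum; apply: eq_bigr => i _.
by rewrite coefXM linearZ.
Qed.

Lemma polyopX u : polyop 'X u = T u.
Proof. by rewrite -[X in polyop X](mulr1 'X) polyopXM (polyopC 1) scale1r. Qed.

Lemma polyopM p q u : polyop (p * q) u = polyop p (polyop q u).
Proof.
elim/poly_ind: p q u => [|p c IH] q u.
  by rewrite mul0r -![polyop 0 _]/(polyop_at _ 0) !linear0.
rewrite mulrDl -mulrA.
have D r s v : polyop (r + s) v = polyop r v + polyop s v.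
  exact: (linearD (polyop_at v)).
rewrite !D IH polyopXM mul_polyC polyopC; congr (_ + _); last first.
  exact: (linearZ_LR (polyop_at u)).
by rewrite IH polyopX.
Qed.

Lemma polyopXsubC c u : polyop ('X - c%:P) u = T u - c *: u.
Proof.
by rewrite -[LHS]/(polyop_at u _) linearB /= /polyop_at polyopC polyopX.
Qed.

Lemma polyop_comm p q u : polyop p (polyop q u) = polyop q (polyop p u).
Proof. by rewrite -!polyopM mulrC. Qed.

Definition algebraic_for : set M :=
  [set u | exists2 p, p != 0 & polyop p u = 0].

Lemma algebraic_subspace : subspace algebraic_for.
Proof.
apply: subspaceP => [|c u v [p p0 pu] [q q0 qv]].
  by exists 1; [exact: oner_neq0 | rewrite linear0].
exists (p * q); first by rewrite mulf_neq0.
have pqu : polyop (p * q) u = 0 by rewrite mulrC polyopM pu linear0.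
have pqv : polyop (p * q) v = 0 by rewrite polyopM qv linear0.
by rewrite linearP /= pqu pqv scaler0 addr0.
Qed.

Lemma algebraic_polyop p u :
  p != 0 -> algebraic_for (polyop p u) -> algebraic_for u.
Proof.
by move=> p0 [q q0 qpu]; exists (q * p); rewrite ?mulf_neq0 // polyopM.
Qed.

End PolynomialOperator.

(** * Algebraicity over an uncountable field *)

Section CountableDimension.
Context {K : numFieldType} {M : lmodType K}.

Definition countable_dim : Prop :=
  exists v : nat -> M,
    forall S, subspace S -> (forall k, S (v k)) -> forall x, S x.

Lemma countable_dim_coordinates : countable_dim ->
  exists v : nat -> M,
    forall x, exists N (c : nat -> K), x = \sum_(i < N) c i *: v i.
Proof.
move=> [v vS]; exists v; apply: vS => [|k]; last first.
  exists k.+1, (fun i => (i == k)%:R); rewrite big_ord_recr /= eqxx scale1r.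
  by rewrite big1 ?add0r // => i _; rewrite ltn_eqF ?scale0r.
apply: subspaceP => [|d x y [m [c ->]] [n [e ->]]].
  by exists 0%N, (fun=> 0); rewrite big_ord0.
have widen k (f : nat -> K) : (k <= maxn m n)%N -> \sum_(i < k) f i *: v i =
    \sum_(i < maxn m n) (if (i < k)%N then f i else 0) *: v i.
  move=> kN; rewrite (big_ord_widen _ (fun i => f i *: v i) kN) big_mkcond.
  by apply: eq_bigr => i _; case: ifP; rewrite ?scale0r.
rewrite (widen m) ?leq_maxl // (widen n) ?leq_maxr // scaler_sumr -big_split.
exists (maxn m n), (fun i => d * (if (i < m)%N then c i else 0) +
  (if (i < n)%N then e i else 0)).
by apply: eq_bigr => i _; rewrite scalerDl scalerA.
Qed.

(** Were [x] not algebraic, the vectors [(T - l)^-1 x] would be linearly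
    independent. Uncountably many of them cannot live in the increasing union of
    countably many finite-dimensional subspaces. *)
Lemma algebraic_of_resolvent (T : {linear M -> M}) x :
  ~ countable [set: K] -> countable_dim ->
  (forall l, exists y, T y - l *: y = x) -> algebraic_for T x.
Proof.
move=> Kunc /countable_dim_coordinates [v vP] resolvent.
have [y yP] := choice resolvent.
have [N NP] := choice (fun l => vP (y l)).
have [c cP] := choice NP.
(* Infinitely many [y l] are combinations of the same [v 0, ..., v (n - 1)], and
   any [n + 1] of these are linearly dependent. *)
have [n ninf] : exists n, infinite_set [set l | N l = n].
  apply: contrapT => fin; apply: Kunc.
  have -> : [set: K] = \bigcup_(n in [set: nat]) [set l | N l = n].
    by apply/seteqP; split=> l // _; exists (N l).
  apply: bigcup_countable => // n _; apply: finite_set_countable.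
  by apply: contrapT => ninf; apply: fin; exists n.
have [B BN Bn] := infinite_set_fset n.+1 ninf.
pose s (j : 'I_n.+1) : K := nth 0 (enum_fset B) j.
have sB j : s j \in B by apply: mem_nth; apply: leq_trans Bn.
have s_inj : injective s.
  move=> i j /eqP; rewrite nth_uniq ?fset_uniq //; last 2 first.
  - by apply: leq_trans Bn.
  - by apply: leq_trans Bn.
  by move=> /eqP ij; apply: val_inj.
pose A := \matrix_(j < n.+1, i < n) c (s j) i.
have [d dA d0] : exists2 d : 'rV_n.+1, d *m A = 0 & d != 0.
  have : kermx A != 0.
    rewrite -mxrank_eq0 mxrank_ker subn_eq0 -ltnNge ltnS; exact: rank_leq_col.
  by move=> /rowV0Pn [d /sub_kermxP dA d0]; exists d.
have dy : \sum_j d 0 j *: y (s j) = 0.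
  under eq_bigr => j _.
    rewrite cP (BN _ (sB j)) scaler_sumr.
    under eq_bigr => i _ do rewrite scalerA.
    over.
  rewrite exchange_big big1 //= => i _; rewrite -scaler_suml.
  have := congr1 (fun m : 'rV_n => m 0 i) dA; rewrite !mxE => e.
  rewrite (eq_bigr (fun j => d 0 j * A j i)) ?e ?scale0r // => j _.
  by rewrite mxE.
(* Clearing denominators in [\sum_j d_j (T - s_j)^-1 x = 0]. *)
pose Q j := \prod_(i | i != j) ('X - (s i)%:P).
exists (\sum_j d 0 j *: Q j).
  have [j dj] : exists j, d 0 j != 0.
    apply: contrapT => dj; case/negP: d0; apply/eqP/rowP => j; rewrite mxE.
    by apply: contrapT => /eqP ?; apply: dj; exists j.
  apply/eqP => /(congr1 (fun p => p.[s j])); rewrite horner0 horner_sum.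
  rewrite (bigD1 j) //= big1 ?addr0 => [|i ij].
    rewrite hornerZ horner_prod => /eqP; rewrite mulf_eq0 (negbTE dj) /=.
    apply/negP/prodf_neq0 => i ij; rewrite hornerXsubC subr_eq0.
    by apply: contra_neq ij => /s_inj ->.
  rewrite hornerZ horner_prod (bigD1 j) 1?eq_sym //=.
  by rewrite hornerXsubC subrr mul0r mulr0.
pose P := \prod_i ('X - (s i)%:P).
have QE j : polyop T (Q j) x = polyop T P (y (s j)).
  rewrite -(yP (s j)) -polyopXsubC -polyopM; congr polyop.
  by rewrite /P (bigD1 j) //= mulrC.
rewrite -[polyop _ _ x]/(polyop_at T x _) linear_sum.
transitivity (polyop T P (\sum_j d 0 j *: y (s j))); last by rewrite dy linear0.
rewrite linear_sum; apply: eq_bigr => j _.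
by rewrite (linearZ_LR (polyop_at T x)) linearZ /= /polyop_at QE.
Qed.

End CountableDimension.

Section SimpleLeftIdeals.
Context {K : numFieldType} {A : lmodType K} (mul : A -> A -> A).
Hypothesis mul_linear : forall a, linear (mul a).
Variable T : {linear A -> A}.
Hypothesis T_mul : forall a x, T (mul a x) = mul a (T x).
Hypothesis T_ideal : forall J, left_ideal mul J -> forall x, J x -> J (T x).

HB.instance Definition _ a :=
  GRing.isLinear.Build K A A *:%R (mul a) (mul_linear a).

Lemma polyop_mul p a x : polyop T p (mul a x) = mul a (polyop T p x).
Proof.
have iter_mul i : iter i T (mul a x) = mul a (iter i T x).
  by elim: i => [|i /= ->]; rewrite ?T_mul.
rewrite /polyop linear_sum; apply: eq_bigr => i _.
by rewrite iter_mul linearZ.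
Qed.

(** For each [l] the left ideal [(T - l) J] of the simple left ideal [J] is [0]
    or [J]: either [T] is a scalar on [J], or all resolvents exist. *)
Lemma algebraic_simple_ideal J : ~ countable [set: K] -> @countable_dim K A ->
  simple_left_ideal mul J -> J `<=` algebraic_for T.
Proof.
move=> Kunc Acount [[J_sub J_mul] J0 J_min].
have J_ideal : left_ideal mul J by split.
pose TJ l := (fun x => T x - l *: x) @` J.
have TJ_ideal l : left_ideal mul (TJ l).
  split.
    apply: subspaceP => [|c _ _ [x Jx <-] [y Jy <-]].
      by exists 0; [exact: subspace0 | rewrite linear0 scaler0 subr0].
    exists (c *: x + y); first by apply: subspaceD => //; apply: subspaceZ.
    by rewrite linearP scalerDr scalerBr !scalerA mulrC opprD addrACA.
  move=> a _ [x Jx <-]; exists (mul a x); first exact: J_mul.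
  by rewrite T_mul (linearB (mul a)) (linearZ_LR (mul a)).
have TJ_sub l : TJ l `<=` J.
  move=> _ [x Jx <-]; apply: subspaceB => //; first exact: T_ideal.
  exact: subspaceZ.
case: (pselect (exists l, TJ l = [set 0])) => [[l TJ0] x Jx|noscalar].
  exists ('X - l%:P); first by rewrite polyXsubC_eq0.
  by rewrite polyopXsubC; have : TJ l (T x - l *: x) by [exists x]; rewrite TJ0.
have onto l : TJ l = J.
  have [|//] := J_min _ (TJ_ideal l) (@TJ_sub l) => TJ0.
  by case: noscalar; exists l.
have [x Jx x0] : exists2 x, J x & x != 0.
  apply: contrapT => nox; apply: J0; apply/seteqP; split=> [x Jx|_ ->] /=.
    by apply: contrapT => /eqP x0; apply: nox; exists x.
  exact: subspace0.
have [p p0 px] : algebraic_for T x.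
  apply: algebraic_of_resolvent => // l; move: Jx; rewrite -(onto l).
  by move=> [y _ yx]; exists y.
(* The relation found at [x] cuts out a nonzero left ideal, hence all of [J]. *)
pose J' := [set z | J z /\ polyop T p z = 0].
have J'_ideal : left_ideal mul J'.
  split=> [|a z [Jz pz]]; last first.
    by split; [exact: J_mul | rewrite polyop_mul pz linear0].
  apply: subspaceP => [|c y z [Jy py] [Jz pz]].
    by split; [exact: subspace0 | rewrite linear0].
  split; first by apply: subspaceD => //; apply: subspaceZ.
  by rewrite linearP /= py pz scaler0 addr0.
have J'J : J' `<=` J by move=> z [].
case: (J_min _ J'_ideal J'J) => J'E.
  have : J' x by []; rewrite J'E => /= x00; by rewrite x00 eqxx in x0.
by move=> z; rewrite -J'E => -[_ pz]; exists p.
Qed.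

Lemma algebraic_semisimple : ~ countable [set: K] -> @countable_dim K A ->
  semisimple_algebra mul -> forall x, algebraic_for T x.
Proof.
move=> Kunc Acount [I [J [J_simple J_sum]]].
apply: (direct_sum_ind J_sum); first exact: algebraic_subspace.
by move=> i; apply: algebraic_simple_ideal.
Qed.

End SimpleLeftIdeals.

(** * The class of the conformal vector is algebraic in Zhu's algebra *)

Section ZhuQuotient.
Context {K : numFieldType} (V : voa K).

Local Notation A := (zhu_quot V).
Local Notation O := (@zhu_O K V).
Let omega := voa_omega V.

Lemma zhu_pi_linear : linear (\pi_A : V -> A).
Proof. by move=> c x y; rewrite pi_zhuD pi_zhu_scale. Qed.

Lemma zhu_pi0 : \pi_A 0 = 0.
Proof. by apply: (addrI (\pi_A 0)); rewrite -pi_zhuD !addr0. Qed.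

Lemma zhu_pi_eq (x y : V) : O (x - y) -> \pi_A x = \pi_A y.
Proof.
move=> Oxy; apply/eqP; rewrite -[_ == _]/(\pi_A x == \pi_A y).
by rewrite piE Quotient.equivE; apply/mem_set.
Qed.

Lemma zhu_pi_eq0 (x : V) : \pi_A x = 0 -> O x.
Proof.
rewrite -zhu_pi0 => /eqP; rewrite piE Quotient.equivE subr0; exact: set_mem.
Qed.

Lemma zhu_reprK (x : V) : O (x - repr (\pi_A x)).
Proof.
have : \pi_A x == \pi_A (repr (\pi_A x)) by rewrite reprK.
by rewrite piE Quotient.equivE => /set_mem.
Qed.

(** Well defined because [O(V)] is a two-sided ideal. *)
Lemma zhu_mul_pi (a x : V) :
  zhu_mul V (\pi_A a) (\pi_A x) = \pi_A (zhu_star a x).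
Proof.
have O_sub := zhu_O_subspace V.
rewrite /zhu_mul; unlock; apply/esym; apply: zhu_pi_eq.
set a' := repr _; set x' := repr _.
rewrite -(subrKA (zhu_star a x')); apply: subspaceD => //.
  rewrite -linearB; apply: zhu_starO; exact: zhu_reprK.
rewrite -[zhu_star a x' - _]/(star_on x' a - star_on x' a') -linearB.
apply: zhu_star_Ol; exact: zhu_reprK.
Qed.

Lemma zhu_mul_linear (a : A) : linear (zhu_mul V a).
Proof.
move=> c x y; elim/quotW: a => a; elim/quotW: x => x; elim/quotW: y => y.
by rewrite -zhu_pi_linear !zhu_mul_pi linearP zhu_pi_linear.
Qed.

HB.instance Definition _ a :=
  GRing.isLinear.Build K A A *:%R (zhu_mul V a) (zhu_mul_linear a).

Lemma voa_countable_dim : @countable_dim K V.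
Proof.
have [s sP] := choice (@voa_wt_fin K V).
pose v k := if (choice.unpickle k : option (int * nat)) is Some (n, i)
  then nth 0 (s n) i else 0.
exists v => S S_sub Sv; apply: (direct_sum_ind (voa_grading V)) => // n x.
move=> /(sP n) [m [c [w [ws ->]]]]; apply: subspace_sum => // i.
apply: subspaceZ => //; have /nthP := ws i => /(_ 0) [j _ <-].
by have := Sv (choice.pickle (n, j)); rewrite /v choice.pickleK.
Qed.

Lemma zhu_countable_dim : @countable_dim K A.
Proof.
have [v vP] := voa_countable_dim; exists (fun k => \pi_A (v k)) => S S_sub Sv x.
elim/quotW: x; apply: (vP (fun x => S (\pi_A x))) => //.
apply: subspaceP => [|c x y Sx Sy].
  by rewrite zhu_pi0; apply: subspace0.
by rewrite zhu_pi_linear; apply: subspaceD => //; apply: subspaceZ.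
Qed.

Lemma zhu_omega_algebraic (x : V) : ~ countable [set: K] ->
  semisimple_algebra (zhu_mul V) ->
  exists2 p, p != 0 & O (polyop (zhu_star omega) p x).
Proof.
move=> Kunc ss.
pose T : {linear A -> A} := zhu_mul V (\pi_A omega).
have T_mul (a y : A) : T (zhu_mul V a y) = zhu_mul V a (T y).
  elim/quotW: a => a; elim/quotW: y => y; rewrite /T /= !zhu_mul_pi.
  by apply: zhu_pi_eq; apply: zhu_star_omega_comm.
have T_ideal J : left_ideal (zhu_mul V) J -> forall y, J y -> J (T y).
  by move=> [_ J_mul] y; apply: J_mul.
have [p p0 px] := algebraic_semisimple zhu_mul_linear T_mul T_ideal Kunc
  zhu_countable_dim ss (\pi_A x).
exists p => //; apply: zhu_pi_eq0; rewrite -px /polyop.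
have iterE i : \pi_A (iter i (zhu_star omega) x) = iter i T (\pi_A x).
  by elim: i => //= i <-; rewrite /T /= zhu_mul_pi.
elim/big_ind2: _ => [|x1 y1 x2 y2 e1 e2|i _].
- exact: zhu_pi0.
- by rewrite pi_zhuD e1 e2.
- by rewrite pi_zhu_scale iterE.
Qed.

End ZhuQuotient.

(** * Local finiteness of L(0) on admissible modules *)

Section LocalFiniteness.
Context {K : numFieldType} {V : voa K} (M : admissible_module V).
Implicit Types (a b : V) (u : M).

Local Notation O := (@zhu_O K V).
Local Notation L0 := (wm_L M 0).
Let omega := voa_omega V.

Definition locally_finite : set M := algebraic_for L0.

Let N_sub : subspace locally_finite := algebraic_subspace L0.

(** Since [(L(0) - d) a(n) = a(n) L(0)] with [d = wt a - n - 1], a relation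
    [p(L(0)) u = 0] is carried to [p(L(0) - d) a(n)u = 0]. *)
Lemma locally_finite_mode k n a u : voa_wt V k a ->
  locally_finite u -> locally_finite (wm_Y M a n u).
Proof.
move=> ka [p p0 pu]; pose d : K := (k - n - 1)%:~R.
have shift q v : polyop L0 (q \Po ('X - d%:P)) (wm_Y M a n v) =
    wm_Y M a n (polyop L0 q v).
  elim/poly_ind: q v => [|q c IH] v.
    by rewrite comp_poly0 -!/(polyop_at _ _ 0) !linear0.
  have D r s w : polyop L0 (r + s) w = polyop L0 r w + polyop L0 s w.
    exact: (linearD (polyop_at L0 w)).
  rewrite comp_polyD comp_polyM comp_polyX comp_polyC !D !polyopC.
  rewrite linearD linearZ /=; congr (_ + _).
  rewrite !polyopM polyopX polyopXsubC (L0_mode _ _ ka).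
  by rewrite addrK IH.
exists (p \Po ('X - d%:P)); first by rewrite comp_poly2_eq0 ?size_XsubC.
by rewrite shift pu linear0.
Qed.

(** The zero mode [o(a) = a(wt a - 1)], as a linear function of [a]. *)
Definition zero_mode (u : M) (a : V) : M :=
  extend (voa_grading V) (fun n => mode_of (n - 1) u : {linear V -> M}) a.

HB.instance Definition _ u := GRing.isLinear.Build K V M *:%R (zero_mode u)
  (extend_is_linear (@voa_wt_subspace K V) (voa_grading V) _).

Lemma zero_modeE u k a : voa_wt V k a -> zero_mode u a = wm_Y M a (k - 1) u.
Proof. exact: (extendE (@voa_wt_subspace K V)). Qed.

Variables (m : nat) (u : M).
Hypothesis u_gr : @am_gr K V M m u.
Hypothesis lower :
  forall j v, (j < m)%N -> @am_gr K V M j v -> locally_finite v.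

Lemma lowering_mode k n a : voa_wt V k a -> k <= n ->
  locally_finite (wm_Y M a n u).
Proof.
move=> ka kn; have := am_mode n ka u_gr.
case E : (_ - 1) => [j|j] /=; first by apply: lower; lia.
by move=> ->; apply: subspace0.
Qed.

(** [o(a o b) u] is the right-hand side of the Jacobi identity at [(l, m, n)]
    equal to [(-2, wt a, wt b)]; every term on the left first applies a lowering
    mode to [u]. *)
Lemma zero_mode_O x : O x -> locally_finite (zero_mode u x).
Proof.
move: x; apply: zhu_O_ind => [|k l a b ka lb].
  apply: subspaceP; first by rewrite linear0; apply: subspace0.
  move=> c x y Nx Ny; rewrite linearP.
  by apply: subspaceD => //; apply: subspaceZ.
rewrite /smode bsum_linear; last exact: (@modes_eventually0 _ _ (adjoint V)).
have -> : bsum k (zero_mode u \o (fun i : nat => voa_Y V a (i%:Z + -2) b)) =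
    bsum k (fun i => wm_Y M (voa_Y V a (-2 + i%:Z) b) (k + l - i%:Z) u).
  apply: eq_bsum => i /=; rewrite (zero_modeE _ (wt_mode _ ka lb)).
  rewrite (_ : i%:Z + -2 = -2 + i%:Z); last by lia.
  by rewrite (_ : k + l - (-2 + i%:Z) - 1 - 1 = k + l - i%:Z) //; lia.
rewrite /bsum -wm_jacobi; apply: subspaceB => //.
  apply: subspace_fsum => // i; apply: subspaceZ => //.
  by apply: locally_finite_mode ka _; apply: lowering_mode lb _; lia.
apply: subspace_fsum => // i; apply: subspaceZ => //.
by apply: locally_finite_mode lb _; apply: lowering_mode ka _; lia.
Qed.

(** The Jacobi identity at [(l, m, n)] equal to [(-1, 2, wt b - 1)]: the first
    term on the left is [omega(1) b(wt b - 1) u = L(0) o(b) u], all others first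
    apply a lowering mode to [u]. *)
Lemma zero_mode_star b :
  locally_finite (zero_mode u (zhu_star omega b) - L0 (zero_mode u b)).
Proof.
move: b; apply: (direct_sum_ind (voa_grading V)) => [|l b lb].
  apply: subspaceP => [|c x y Nx Ny].
    by rewrite !linear0 addr0; apply: subspace0.
  rewrite !linearP addrACA -scalerDr.
  by apply: subspaceD => //; apply: subspaceZ.
have omega2 : voa_wt V 2 omega by apply: voa_wt_omega.
rewrite (zhu_starE _ omega2) (zero_modeE _ lb) /smode bsum_linear; last first.
  exact: (@modes_eventually0 _ _ (adjoint V)).
have -> : bsum 2 (zero_mode u \o (fun i : nat => voa_Y V omega (i%:Z + -1) b)) =
    bsum 2 (fun i =>
      wm_Y M (voa_Y V omega (-1 + i%:Z) b) (2 + (l - 1) - i%:Z) u).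
  apply: eq_bsum => i /=; rewrite (zero_modeE _ (wt_mode _ omega2 lb)).
  rewrite (_ : i%:Z + -1 = -1 + i%:Z); last by lia.
  by rewrite (_ : 2 + l - (-1 + i%:Z) - 1 - 1 = 2 + (l - 1) - i%:Z) //; lia.
rewrite /bsum -wm_jacobi nsumS; last first.
  have [N hN] := modes_eventually0 b (l - 1) u.
  by exists N => i iN; rewrite (addrC (l - 1)) hN // linear0 scaler0.
rewrite expr0 binz0 mulr1 scale1r.
rewrite (_ : -1 + 2 - 0%:Z = 0 + 1) // (_ : l - 1 + 0%:Z = l - 1); last by lia.
rewrite -/(wm_L M 0) [X in _ X]addrC !addrA addNr add0r.
apply: subspaceB => //.
  apply: subspace_fsum => // i; apply: subspaceZ => //.
  by apply: locally_finite_mode omega2 _; apply: lowering_mode lb _; lia.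
apply: subspace_fsum => // i; apply: subspaceZ => //.
by apply: locally_finite_mode lb _; apply: lowering_mode omega2 _; lia.
Qed.

Lemma zero_mode_polyop p b : locally_finite
  (zero_mode u (polyop (zhu_star omega) p b) - polyop L0 p (zero_mode u b)).
Proof.
have omega2 : voa_wt V 2 omega by apply: voa_wt_omega.
have iterE i : locally_finite
    (zero_mode u (iter i (zhu_star omega) b) - iter i L0 (zero_mode u b)).
  elim: i => [|i IH] /=; first by rewrite subrr; apply: subspace0.
  rewrite -(subrKA (L0 (zero_mode u (iter i (zhu_star omega) b)))).
  apply: subspaceD => //; first exact: zero_mode_star.
  by rewrite -(linearB L0); apply: (locally_finite_mode (0 + 1) omega2 IH).
rewrite /polyop linear_sum -sumrB; apply: subspace_sum => // i.
rewrite (linearZ_LR (zero_mode u)) -scalerBr.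
exact: (subspaceZ N_sub) (iterE i).
Qed.

Lemma locally_finite_step p :
  p != 0 -> O (polyop (zhu_star omega) p (voa_one V)) -> locally_finite u.
Proof.
move=> p0 Op; apply: (algebraic_polyop p0).
have u1 : zero_mode u (voa_one V) = u.
  by rewrite (zero_modeE _ (voa_wt_one V)) wm_vacuum.
have := zero_mode_polyop p (voa_one V); rewrite u1.
set x := zero_mode u _ => h; rewrite -[polyop L0 p u](subKr x).
by apply: subspaceB => //; apply: zero_mode_O.
Qed.

End LocalFiniteness.

Lemma locally_finite_module (K : numFieldType) (V : voa K)
    (M : admissible_module V) :
  ~ countable [set: K] -> semisimple_algebra (zhu_mul V) ->
  forall u : M, locally_finite u.
Proof.
move=> Kunc ss; have [p p0 Op] := zhu_omega_algebraic (voa_one V) Kunc ss.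
apply: (direct_sum_ind (@am_grading K V M)) => [|m].
  exact: algebraic_subspace.
elim/ltn_ind: m => m IH u um; apply: (locally_finite_step um _ p0 Op).
by move=> j v jm; apply: IH.
Qed.

(** * Generalized eigenspace decomposition *)

Section DirectSumCriterion.
Context {K : fieldType} {I : choiceType} {M : lmodType K} (E : I -> set M).
Hypothesis E_sub : forall i, subspace (E i).

Lemma direct_sum_criterion :
  (forall S, subspace S -> (forall i, E i `<=` S) -> forall x, S x) ->
  (forall f, (forall i, E i (f i)) -> finitely_supported f ->
     \sum_(i \in [set: I]) f i = 0 -> forall i, f i = 0) ->
  direct_sum E.
Proof.
move=> span indep.
pose S (x : M) := exists f : I -> M,
  [/\ forall i, E i (f i), finitely_supported f &
      x = \sum_(i \in [set: I]) f i].
have supp c (f g : I -> M) : finitely_supported f -> finitely_supported g ->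
    finitely_supported (fun i => c *: f i + g i).
  move=> ff fg; apply: (@sub_finite_set _ _ ([set i | f i != 0] `|`
    [set i | g i != 0])); last by rewrite finite_setU.
  move=> i /= h; case: (eqVneq (f i) 0) => fi; last by left.
  by right; apply: contra_neq h => ->; rewrite fi scaler0 addr0.
have sum c (f g : I -> M) : finitely_supported f -> finitely_supported g ->
    \sum_(i \in [set: I]) (c *: f i + g i) =
    c *: (\sum_(i \in [set: I]) f i) + \sum_(i \in [set: I]) g i.
  move=> ff fg.
  exact: (fsum_linear c (fun=> idfun : {linear M -> M}) ff fg).
have mem c (f g : I -> M) : (forall i, E i (f i)) -> (forall i, E i (g i)) ->
    forall i, E i (c *: f i + g i).
  by move=> Ef Eg i; apply: subspaceD => //; apply: subspaceZ.
have S_sub : subspace S.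
  apply: subspaceP => [|c x y [f [Ef ff ->]] [g [Eg fg ->]]].
    exists (fun=> 0); split=> [i||]; first exact: subspace0.
      by apply: (sub_finite_set _ (finite_set0 I)) => i /=; rewrite eqxx.
    by rewrite fsbig1.
  exists (fun i => c *: f i + g i).
  by split; [exact: mem | exact: supp | rewrite sum].
have E_S i : E i `<=` S.
  move=> x Ex; exists (fun j => if j == i then x else 0).
  have sx : [set j | (if j == i then x else 0) != 0] `<=` [set` [fset i]%fset].
    by move=> j /=; rewrite inE; case: (j =P i); rewrite ?eqxx.
  split=> [j||]; first by case: eqP => [->|_] //; apply: subspace0.
    exact: sub_finite_set sx (finite_fset _).
  by rewrite (fsumE sx) big_seq_fset1 eqxx.
move=> x; have [f [Ef ff xf]] := span S S_sub E_S x.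
exists f; split=> // g [Eg fg xg]; apply/funext => i.
have := indep (fun i => (-1) *: f i + g i) (mem _ _ _ Ef Eg) (supp _ _ _ ff fg).
rewrite sum // -xf -xg scaleN1r addNr => /(_ erefl i) /eqP.
by rewrite scaleN1r addrC subr_eq0 => /eqP ->.
Qed.

End DirectSumCriterion.

Section GeneralizedEigenspaces.
Context {K : closedFieldType} {M : lmodType K} (T : {linear M -> M}).

Definition primary (l : K) : set M :=
  [set u | exists k : nat, iter k (fun x => T x - l *: x) u = 0].

Lemma iter_polyop k l u :
  iter k (fun x => T x - l *: x) u = polyop T (('X - l%:P) ^+ k) u.
Proof.
elim: k => [|k IH] /=; first by rewrite expr0 (polyopC _ 1) scale1r.
by rewrite IH exprS polyopM polyopXsubC.
Qed.

Lemma primary_subspace l : subspace (primary l).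
Proof.
apply: subspaceP => [|c u v [i ui] [j vj]]; first by exists 0%N.
exists (i + j)%N; rewrite iter_polyop in ui; rewrite iter_polyop in vj.
rewrite iter_polyop linearP exprD /=.
have -> : polyop T (('X - l%:P) ^+ i * ('X - l%:P) ^+ j) u = 0.
  by rewrite mulrC polyopM ui linear0.
by rewrite polyopM vj !linear0 addr0.
Qed.

Lemma polyop_bezout p q u : coprimep p q ->
  exists r s, u = polyop T (r * p) u + polyop T (s * q) u.
Proof.
move=> /Bezout_eq1_coprimepP [[r s] /= rs1]; exists r, s.
rewrite -[RHS](linearD (polyop_at T u)) rs1.
by rewrite -[1]/(1%:P) /= /polyop_at polyopC scale1r.
Qed.

(** By induction on the degree: if [p = q (X - l)^k] with [q(l) <> 0], a Bezout
    relation splits [u] into a vector of [primary l] and one killed by [q]. *)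
Lemma primary_span (S : set M) u : subspace S -> (forall l, primary l `<=` S) ->
  algebraic_for T u -> S u.
Proof.
move=> S_sub prS [p]; have [n] := ubnP (size p).
elim: n => // n IH in p u *; rewrite ltnS => pn p0 pu.
have [p1|] := eqVneq (size p) 1%N.
  have /size_poly1P [c c0 pc] : size p == 1%N by rewrite p1.
  move: pu; rewrite pc polyopC => /eqP.
  rewrite scaler_eq0 (negbTE c0) => /eqP ->.
  exact: subspace0.
move=> /closed_rootP [l pl].
have [k [q ql pE]] := multiplicity_XsubC p l; rewrite p0 /= in ql.
have k0 : (0 < k)%N.
  by case: k pE => // pE; move: pl; rewrite pE expr0 mulr1 (negbTE ql).
have q0 : q != 0 by apply: contraNneq ql => ->; rewrite root0.
have cop : coprimep q (('X - l%:P) ^+ k).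
  by rewrite coprimep_expr // coprimep_XsubC.
have [r [s ->]] := polyop_bezout u cop; apply: subspaceD => //.
  apply: (prS l); exists k.
  by rewrite iter_polyop -polyopM mulrCA [_ * q]mulrC -pE polyopM pu linear0.
apply: (IH q) => //.
  rewrite (leq_trans _ pn) // pE size_Mmonic ?monic_exp ?monicXsubC //.
  by rewrite size_exp_XsubC addnS /= -addn1 leq_add2l.
by rewrite -polyopM mulrCA -pE polyopM pu linear0.
Qed.

Lemma direct_sum_primary : (forall u, algebraic_for T u) -> direct_sum primary.
Proof.
move=> alg; apply: direct_sum_criterion.
- exact: primary_subspace.
- by move=> S S_sub prS u; apply: primary_span.
move=> f Ef ff f0 l.
have [k kP] := choice Ef.
pose A := fset_set [set i | f i != 0].
have fA : [set i | f i != 0] `<=` [set` A] by rewrite /A fset_setK.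
rewrite (fsumE fA) in f0.
(* The product [q] kills every component but the one at [l], and is coprime to
   the power of [X - l] that kills that one. *)
pose F i : {poly K} := if i == l then 1 else ('X - i%:P) ^+ k i.
pose q := \prod_(i <- A) F i.
have qf i : i != l -> i \in A -> polyop T q (f i) = 0.
  move=> il iA; rewrite /q (bigD1_seq i) ?fset_uniq //= /F (negbTE il).
  by rewrite mulrC polyopM -iter_polyop kP linear0.
have qfl : polyop T q (f l) = 0.
  have [lA|lA] := boolP (l \in A); last first.
    have -> : f l = 0 by apply: contrapT => /eqP fl; move: lA; rewrite (fA l).
    exact: linear0.
  have := congr1 (polyop T q) f0; rewrite linear0 linear_sum.
  rewrite (bigD1_seq l) ?fset_uniq //= big_seq_cond big1 ?addr0 // => i.
  by move=> /andP[iA il]; apply: qf.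
have cop : coprimep q (('X - l%:P) ^+ k l).
  rewrite coprimep_expr // coprimep_XsubC /root horner_prod.
  rewrite prodf_seq_neq0; apply/allP => i _ /=; rewrite /F.
  case: (i =P l) => [_|/eqP il]; first by rewrite hornerC oner_neq0.
  by rewrite horner_exp hornerXsubC expf_neq0 // subr_eq0 eq_sym.
have [r [s ->]] := polyop_bezout (f l) cop.
by rewrite !polyopM qfl -iter_polyop kP !linear0 addr0.
Qed.

End GeneralizedEigenspaces.

(** * Complex coefficients *)

(** Countable sets of reals are Lebesgue null, and the unit interval is not. *)
Lemma uncountable_complex (R : realType) : ~ countable [set: R[i]%C].
Proof.
move=> /countable_injP[f f_inj]; have : countable [set: R].
  apply/countable_injP; exists (f \o real_complex R) => x y _ _ /= fxy.
  by apply: complexI; apply: f_inj fxy; rewrite in_setT.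
move=> /(sub_countable (subset_card_le (@subsetT _ `]0, 1[%classic))).
move=> /countable_lebesgue_measure0/eqP.
by rewrite lebesgue_measure_itv /= lte_fin ltr01 oppr0 adde0 onee_eq0.
Qed.

Theorem proposition3p3 (R : realType) (V : voa R[i])
    (hA : semisimple_algebra (zhu_mul V)) (M : admissible_module V) :
  direct_sum (gen_eigenspace M).
Proof.
apply: (@direct_sum_primary _ _ (wm_L M 0)) => u.
apply: locally_finite_module => //.
exact: uncountable_complex.
Qed.
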